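(* Let $G=\langle x_1,\ldots,x_k \mid r_1,\ldots,r_m\rangle$ be a non-elementary hyperbolic group and let $H\le G$ be a quasiconvex subgroup of infinite index. Let $a_n$ be the number of freely reduced words in $A=\{x_1,\ldots,x_k\}^{\pm1}$ of length $n$ representing elements of $H$. Let $b_n$ be the number of all words in $A$ of length $n$ representing elements of $H$. Then $$\limsup_{n\to\infty}\sqrt[n]{a_n}<2k-1 \quad\text{and}\quad \limsup_{n\to\infty}\sqrt[n]{b_n}<2k.$$
   Context: A finitely generated group $G$ is (word-)hyperbolic if for any finite generating set $S$ there is $\delta\ge 0$ such that in every geodesic triangle in the Cayley graph $\Gamma(G,S)$ each side is contained in the closed $\delta$-neighborhood of the union of the other two sides. A hyperbolic group is non-elementary if it is not virtually cyclic (finite groups count as virtually cyclic). A subgroup $H$ of a hyperbolic group $G$ is quasiconvex if for any finite generating set $S$ of $G$ there is $\epsilon\ge0$ such that every geodesic in $\Gamma(G,S)$ with both endpoints in $H$ is contained in the $\epsilon$-neighborhood of $H$. Here $\{x_1,\ldots,x_k\}^{\pm1}$ denotes the $2k$-letter alphabet $\{x_1,x_1^{-1},\ldots,x_k,x_k^{-1}\}$. *)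

(* Defs.v *)
From mathcomp Require Import all_boot all_order all_algebra.
From mathcomp Require Import all_classical all_reals all_analysis.

Set Implicit Arguments.
Unset Strict Implicit.
Unset Printing Implicit Defensive.

Import Order.TTheory GRing.Theory Num.Theory.
Local Open Scope classical_set_scope.
Local Open Scope ring_scope.

(* The letter (i, false) stands for x_i and (i, true) for its formal inverse,
   so that over 'I_k there are exactly 2k letters, even when the values of the
   generators in the group coincide. *)
Definition letter (I : Type) : Type := (I * bool)%type.

Definition inv_letter (I : Type) (a : letter I) : letter I := (a.1, ~~ a.2).

Definition letter_val (G : groupType) (I : Type) (x : I -> G) (a : letter I) :
    G :=
  if a.2 then (x a.1)^-1%g else x a.1.

Definition word_val (G : groupType) (I : Type) (x : I -> G)
    (w : seq (letter I)) : G :=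
  (\prod_(a <- w) letter_val x a)%g.

Definition freely_reduced (I : eqType) (w : seq (letter I)) : bool :=
  sorted (fun a b : I * bool => b != inv_letter a) w.

(* The congruence on words whose quotient is the group
   < x_i, i in I | r_j, j in J >. *)
Inductive pres_eq (I J : Type) (r : J -> seq (letter I)) :
    seq (letter I) -> seq (letter I) -> Prop :=
| pres_refl u : pres_eq r u u
| pres_sym u v : pres_eq r u v -> pres_eq r v u
| pres_trans u v w : pres_eq r u v -> pres_eq r v w -> pres_eq r u w
| pres_cat u u' v v' :
    pres_eq r u u' -> pres_eq r v v' -> pres_eq r (u ++ v) (u' ++ v')
| pres_cancel a : pres_eq r [:: a; inv_letter a] [::]
| pres_relator j : pres_eq r (r j) [::].

Definition has_presentation (G : groupType) (I J : Type) (x : I -> G)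
    (r : J -> seq (letter I)) : Prop :=
  (forall g : G, exists w, word_val x w = g) /\
  (forall u v, word_val x u = word_val x v <-> pres_eq r u v).

Definition word_over (G : groupType) (S : set G) (w : seq (letter G)) : Prop :=
  forall a : G * bool, a \in w -> S a.1.

Definition generates (G : groupType) (S : set G) : Prop :=
  forall g : G, exists2 w, word_over S w & word_val id w = g.

Definition finite_generating_set (G : groupType) (S : set G) : Prop :=
  finite_set S /\ generates S.

(* Points of the geometric realization of the Cayley graph: for s in S and
   0 < t < 1, EdgePoint g s t is the point at distance t from g on the edge of
   length 1 going from g to g * s. *)
Inductive cayley_point (R : realType) (G : groupType) : Type :=
| Vertex of G
| EdgePoint of G & G & R.

Arguments Vertex {R G}.

Definition cayley_graph (R : realType) (G : groupType) (S : set G) :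
    set (cayley_point R G) :=
  [set p | if p is EdgePoint _ s t then S s /\ 0 < t < 1 else True].

(* The vertices closing the cell of p, with their distance to p in that cell. *)
Definition cell_ends (R : realType) (G : groupType) (p : cayley_point R G) :
    set (G * R) :=
  match p with
  | Vertex g => [set (g, 0)]
  | EdgePoint g s t => [set (g, t); ((g * s)%g, 1 - t)]
  end.

(* Lengths of the paths from p to q that leave the cell of p through one of its
   ends, follow an edge path, and enter the cell of q through one of its ends,
   or that stay inside a common open edge. *)
Definition path_lengths (R : realType) (G : groupType) (S : set G)
    (p q : cayley_point R G) : set R :=
  [set l | (exists a b w,
              [/\ cell_ends p a, cell_ends q b, word_over S w,
                  (a.1 * word_val id w)%g = b.1 & l = a.2 + (size w)%:R + b.2])
        \/ (exists g s t u,
              [/\ p = EdgePoint g s t, q = EdgePoint g s u & l = `|t - u|])].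

Definition cayley_dist (R : realType) (G : groupType) (S : set G)
    (p q : cayley_point R G) : R :=
  inf (path_lengths S p q).

Definition geodesic (R : realType) (G : groupType) (S : set G) (L : R)
    (c : R -> cayley_point R G) : Prop :=
  [/\ 0 <= L,
      forall t, 0 <= t <= L -> cayley_graph S (c t) &
      forall t u, 0 <= t <= L -> 0 <= u <= L ->
        cayley_dist S (c t) (c u) = `|t - u|].

Definition trace (R : realType) (G : groupType) (L : R)
    (c : R -> cayley_point R G) : set (cayley_point R G) :=
  [set c t | t in [set t | 0 <= t <= L]].

Definition neighborhood (R : realType) (G : groupType) (S : set G) (e : R)
    (A : set (cayley_point R G)) : set (cayley_point R G) :=
  [set p | exists2 q, A q & cayley_dist S p q <= e].

Definition thin_triangles (R : realType) (G : groupType) (S : set G)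
    (delta : R) : Prop :=
  forall (L1 L2 L3 : R) (c1 c2 c3 : R -> cayley_point R G),
    geodesic S L1 c1 -> geodesic S L2 c2 -> geodesic S L3 c3 ->
    c1 L1 = c2 0 -> c2 L2 = c3 0 -> c3 L3 = c1 0 ->
    [/\ trace L1 c1 `<=` neighborhood S delta (trace L2 c2 `|` trace L3 c3),
        trace L2 c2 `<=` neighborhood S delta (trace L3 c3 `|` trace L1 c1) &
        trace L3 c3 `<=` neighborhood S delta (trace L1 c1 `|` trace L2 c2)].

Definition hyperbolic (R : realType) (G : groupType) : Prop :=
  (exists S : set G, finite_generating_set S) /\
  (forall S : set G, finite_generating_set S ->
     exists2 delta : R, 0 <= delta & thin_triangles S delta).

Definition finite_index (G : groupType) (A : set G) : Prop :=
  finite_set (range (fun g : G => [set (g * h)%g | h in A])).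

Definition cyclic_subgroup (G : groupType) (g : G) : set G :=
  [set h | exists n : nat, h = (g ^+ n)%g \/ h = (g ^- n)%g].

Definition virtually_cyclic (G : groupType) : Prop :=
  exists g : G, finite_index (cyclic_subgroup g).

Definition quasiconvex (R : realType) (G : groupType) (H : groupClosed G) :
    Prop :=
  forall S : set G, finite_generating_set S ->
    exists2 e : R, 0 <= e &
      forall (L : R) (c : R -> cayley_point R G), geodesic S L c ->
        (exists2 h, h \in H & c 0 = Vertex h) ->
        (exists2 h, h \in H & c L = Vertex h) ->
        trace L c `<=` neighborhood S e [set Vertex h | h in [set` H]].

Definition num_reduced_words (G : groupType) (k : nat) (x : 'I_k -> G)
    (H : groupClosed G) (n : nat) : nat :=
  #|[pred w : n.-tuple ('I_k * bool) |
      freely_reduced w && (word_val x w \in H)]|.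

Definition num_words (G : groupType) (k : nat) (x : 'I_k -> G)
    (H : groupClosed G) (n : nat) : nat :=
  #|[pred w : n.-tuple ('I_k * bool) | word_val x w \in H]|.

(* limsup of the n-th roots of a_n, with value in the extended reals *)
Definition growth_rate (R : realType) (a : nat -> nat) : \bar R :=
  limn_esup (fun n => ((a n)%:R `^ n%:R^-1)%:E).

(* Main.v *)
(* Put d(x) for the distance from x to H. In a hyperbolic group two directions
   with small Gromov product cannot both lead from x towards the quasiconvex H,
   so for two independent loxodromic elements u, v the increments of d along
   u, u^-1, v, v^-1 have positive sum when x is far from H; since H has infinite
   index, finitely many further steps correct this near H. Hence some finite
   symmetric set Q has uniformly positive drift, and l^d is superharmonic for Q
   when l < 1 is close to 1. By Barta's argument this yields a spectral gap for
   Q, hence for the generators, on the Schreier graph of H. Both counts are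
   counts of paths of a regular automaton over that graph: a vector almost
   attaining the maximal expansion under two steps of the automaton would have
   components nearly independent of the letter, with a nearly invariant sum,
   contradicting the gap. *)

From HB Require Import structures.
Require Import Defs.
From mathcomp Require Import all_boot all_order all_algebra.
From mathcomp Require Import all_classical all_reals all_analysis.
From mathcomp Require Import zify ring lra.
Local Open Scope ring_scope.

Set Implicit Arguments.
Unset Strict Implicit.
Unset Printing Implicit Defensive.
Import Order.TTheory GRing.Theory Num.Theory.
(** * Word length and geodesics of the Cayley graph *)

(** Thin triangles and quasiconvexity are given for real geodesics in the realization of the Cayley
    graph. Both are turned at once into statements on integer distances between group elements, and
    Gromov products are doubled, so that the coarse geometry becomes linear arithmetic. Bounds on
    Gromov products must be fixed before exponents are chosen, since the powers have to be long
    compared with those bounds.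

    On the analytic side, the step operator for reduced words is not symmetric, so a spectral
    statement does not directly bound its norm. What is used instead is that one step multiplies the
    squared norm by at most [d ^ 2], where [d] letters may follow any given letter, with a defect
    measuring how the components vary with the letter. Equal components attain [d ^ 2], so only two
    steps contract; this is why [th < d ^ 4] and why a fourth root appears in the growth rate. The
    gap for the generators does not exclude functions that nearly alternate on a bipartite graph;
    the vectors counting words are nonnegative, and this excludes them. All functions stay finitely
    supported, so no completion is taken. *)

Section WordLength.
Variables (G : groupType) (S : set G).

Definition spelled (g : G) (n : nat) : Prop :=
  exists w, [/\ word_over S w, word_val id w = g & size w = n].

Definition wlen (g : G) : nat :=
  if pselect (exists n, `[< spelled g n >]) is left e then ex_minn e else 0%N.

Lemma word_over_cat (u v : seq (letter G)) :
  word_over S u -> word_over S v -> word_over S (u ++ v).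
Proof. by move=> Su Sv a; rewrite mem_cat => /orP[/Su|/Sv]. Qed.

Lemma word_over_sub (u v : seq (letter G)) :
  {subset u <= v} -> word_over S v -> word_over S u.
Proof. by move=> uv Sv a /uv /Sv. Qed.

Lemma word_val_cat (I : Type) (x : I -> G) (u v : seq (letter I)) :
  word_val x (u ++ v) = (word_val x u * word_val x v)%g.
Proof. by rewrite /word_val big_cat. Qed.

Lemma word_val_cons (I : Type) (x : I -> G) a (v : seq (letter I)) :
  word_val x (a :: v) = (letter_val x a * word_val x v)%g.
Proof. by rewrite /word_val big_cons. Qed.

Lemma word_val_nil (I : Type) (x : I -> G) : word_val x [::] = 1%g.
Proof. by rewrite /word_val big_nil. Qed.

Lemma letter_val_inv (I : Type) (x : I -> G) (a : letter I) :
  letter_val x (inv_letter a) = (letter_val x a)^-1%g.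
Proof. by case: a => i [] /=; rewrite /letter_val /= ?invgK. Qed.

Definition inv_word (I : Type) (w : seq (letter I)) : seq (letter I) :=
  rev (map (@inv_letter I) w).

Lemma word_val_inv (I : Type) (x : I -> G) (w : seq (letter I)) :
  word_val x (inv_word w) = (word_val x w)^-1%g.
Proof.
elim: w => [|a w IH]; first by rewrite /inv_word /= word_val_nil invg1.
rewrite /inv_word /= rev_cons -cats1 word_val_cat -/(inv_word w) IH.
by rewrite !word_val_cons word_val_nil mulg1 letter_val_inv invgM.
Qed.

Lemma word_over_inv (w : seq (letter G)) :
  word_over S w -> word_over S (inv_word w).
Proof. by move=> Sw a; rewrite mem_rev => /mapP[b /Sw Sb ->]. Qed.

Hypothesis genS : generates S.

Lemma wlenP (g : G) :
  exists w, [/\ word_over S w, word_val id w = g & size w = wlen g].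
Proof.
rewrite /wlen; case: pselect => [e|[]]; last first.
  by have [w Sw wg] := genS g; exists (size w); apply/asboolP; exists w.
by case: ex_minnP => n /asboolP.
Qed.

Lemma wlen_le (w : seq (letter G)) :
  word_over S w -> (wlen (word_val id w) <= size w)%N.
Proof.
move=> Sw; rewrite /wlen; case: pselect => [e|//].
by case: ex_minnP => n _; apply; apply/asboolP; exists w.
Qed.

Lemma wlen1 : wlen 1%g = 0%N.
Proof.
by apply/eqP; rewrite -leqn0 -(word_val_nil id); apply: wlen_le => a.
Qed.

Lemma wlenM (g h : G) : (wlen (g * h)%g <= wlen g + wlen h)%N.
Proof.
have [u [Su ug <-]] := wlenP g; have [v [Sv vh <-]] := wlenP h.
rewrite -size_cat -ug -vh -word_val_cat; apply: wlen_le.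
exact: word_over_cat.
Qed.

Lemma wlenV (g : G) : wlen g^-1%g = wlen g.
Proof.
wlog suff leV : g / (wlen g^-1%g <= wlen g)%N.
  by apply/eqP; rewrite eqn_leq leV -{1}(invgK g) leV.
have [u [Su ug <-]] := wlenP g.
rewrite -ug -word_val_inv -(size_map (@inv_letter G)) -size_rev.
exact/wlen_le/word_over_inv.
Qed.

Lemma wlen_eq0 (g : G) : wlen g = 0%N -> g = 1%g.
Proof.
have [u [_ <- <-]] := wlenP g.
by case: u => // _; rewrite word_val_nil.
Qed.

(** Cut a shortest spelling of [g]: the pieces have length at most [i] and [wlen g - i], and the
    triangle inequality turns both bounds into equalities. *)
Lemma wlen_split (g : G) (i : nat) : (i <= wlen g)%N ->
  exists p, wlen p = i /\ wlen (p^-1 * g)%g = (wlen g - i)%N.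
Proof.
have [w [Sw wg sw]] := wlenP g; rewrite -sw => le_iw.
have Sp : word_over S (take i w) by apply: word_over_sub Sw => a /mem_take.
have Sd : word_over S (drop i w) by apply: word_over_sub Sw => a /mem_drop.
have dE : ((word_val id (take i w))^-1 * g)%g = word_val id (drop i w).
  by rewrite -wg -{2}(cat_take_drop i w) word_val_cat mulKg.
exists (word_val id (take i w)); rewrite dE.
have := wlen_le Sp; have := wlen_le Sd.
have := wlenM (word_val id (take i w)) (word_val id (drop i w)).
rewrite -word_val_cat cat_take_drop wg -sw size_drop size_take_min.
by rewrite (minn_idPl le_iw); move: le_iw; lia.
Qed.

Lemma wlen_ball_finite (n : nat) : finite_set S ->
  exists B : seq G, forall g, (wlen g <= n)%N -> g \in B.
Proof.
move=> /finite_seqP[s Ss].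
elim: n => [|n [B BP]].
  exists [:: 1%g] => g; rewrite leqn0 inE => /eqP /wlen_eq0 ->.
  exact: eqxx.
exists (1%g :: [seq (letter_val id a * h)%g |
  a <- [seq (t, b) | t <- s, b <- [:: true; false]], h <- B]) => g le_gn.
have [w [Sw wg sw]] := wlenP g; rewrite inE -wg.
case: w Sw sw {wg} => [|[t b] w] Sw sw; first by rewrite word_val_nil eqxx.
apply/orP; right; rewrite word_val_cons; apply: allpairs_f.
  apply: (@allpairs_f _ _ _ pair); last by case: (b).
  by have /= := Sw (t, b) (mem_head _ _); rewrite Ss.
apply: BP; have Sw' : word_over S w.
  by apply: word_over_sub Sw => a aw; rewrite inE aw orbT.
by have := wlen_le Sw'; move: sw le_gn => /=; lia.
Qed.
End WordLength.

Section CayleyGeodesics.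
Variables (R : realType) (G : groupType) (S : set G).
Hypothesis genS : generates S.
Local Notation len := (wlen S).

Definition wdist (g h : G) : nat := len (g^-1 * h)%g.

Lemma wdistxx g : wdist g g = 0%N.
Proof. by rewrite /wdist mulVg wlen1. Qed.

Lemma wdistC g h : wdist g h = wdist h g.
Proof. by rewrite /wdist -wlenV // invgM invgK. Qed.

Lemma wdist_triangle h g k : (wdist g k <= wdist g h + wdist h k)%N.
Proof.
rewrite /wdist; have -> : (g^-1 * k = g^-1 * h * (h^-1 * k))%g.
  by rewrite -mulgA mulVKg.
exact: wlenM.
Qed.

Lemma wdistM g h k : wdist (g * h)%g (g * k)%g = wdist h k.
Proof. by rewrite /wdist invgM -mulgA mulKg. Qed.

Variables (g : G) (w : seq (letter G)).

Definition vertex_at (i : nat) : G := (g * word_val id (take i w))%g.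

(* An edge labelled by an inverse letter is traversed backwards, hence is based
   at its far end. *)
Definition geo_path (t : R) : cayley_point R G :=
  let i := Num.trunc t in let s := t - i%:R in
  if s == 0 then Vertex (vertex_at i) else
  let a := nth (1%g, false) w i in
  if a.2 then EdgePoint (vertex_at i.+1) a.1 (1 - s)
  else EdgePoint (vertex_at i) a.1 s.

Hypothesis Sw : word_over S w.
Hypothesis geo_w : size w = len (word_val id w).

Lemma vertex_at0 : vertex_at 0 = g.
Proof. by rewrite /vertex_at take0 word_val_nil mulg1. Qed.

Lemma vertex_at_size : vertex_at (size w) = (g * word_val id w)%g.
Proof. by rewrite /vertex_at take_size. Qed.

Lemma vertex_atS i : (i < size w)%N ->
  vertex_at i.+1 = (vertex_at i * letter_val id (nth (1%g, false) w i))%g.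
Proof.
move=> iw; rewrite /vertex_at (take_nth (1%g, false)) // -cats1 word_val_cat.
by rewrite word_val_cons word_val_nil mulg1 mulgA.
Qed.

Lemma wdist_vertex_at_le i j : (i <= j <= size w)%N ->
  (wdist (vertex_at i) (vertex_at j) <= j - i)%N.
Proof.
move=> /andP[ij jw]; rewrite wdistM /wdist.
have -> : take j w = take i w ++ drop i (take j w).
  by rewrite -(take_takel w ij) cat_take_drop.
rewrite word_val_cat mulKg; apply: leq_trans (wlen_le _) _.
  by apply: word_over_sub Sw => a /mem_drop/mem_take.
by rewrite size_drop size_takel.
Qed.

(** The upper bounds for the pieces before [i], from [i] to [j] and after [j] add up to [size w],
    the distance of the ends, so none can be strict. *)
Lemma wdist_vertex_at i j : (i <= j <= size w)%N ->
  wdist (vertex_at i) (vertex_at j) = (j - i)%N.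
Proof.
move=> ijw; have := wdist_vertex_at_le ijw; move: ijw => /andP[ij jw].
have := @wdist_vertex_at_le 0 i; rewrite vertex_at0 => /(_ _)/=.
have := @wdist_vertex_at_le j (size w); rewrite vertex_at_size => /(_ _)/=.
have := wdist_triangle (vertex_at i) g (g * word_val id w)%g.
have := wdist_triangle (vertex_at j) (vertex_at i) (g * word_val id w)%g.
have -> : wdist g (g * word_val id w)%g = size w.
  by rewrite -{1}(mulg1 g) wdistM /wdist invg1 mul1g geo_w.
have jw' : (j <= size w <= size w)%N by rewrite jw leqnn.
move=> h1 h2 /(_ jw') h3 /(_ (leq_trans ij jw)) h4.
by move: h1 h2 h3 h4 ij jw; lia.
Qed.

Definition ndist (i j : nat) : nat := ((i - j) + (j - i))%N.

Lemma ndist_le i j : (i <= j)%N -> ndist i j = (j - i)%N.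
Proof. by rewrite /ndist; lia. Qed.

Lemma wdist_vertex_atE i j : (i <= size w)%N -> (j <= size w)%N ->
  wdist (vertex_at i) (vertex_at j) = ndist i j.
Proof.
rewrite /ndist => iw jw; have [ij|/ltnW ji] := leqP i j.
  by rewrite wdist_vertex_at ?ij //; lia.
by rewrite wdistC wdist_vertex_at ?ji //; lia.
Qed.

Lemma ndistE i j : (ndist i j)%:R = `|i%:R - j%:R| :> R.
Proof.
rewrite /ndist; have [ij|/ltnW ji] := leqP i j.
  have -> : (i - j + (j - i) = j - i)%N by lia.
  by rewrite natrB // distrC ger0_norm // subr_ge0 ler_nat.
have -> : (i - j + (j - i) = i - j)%N by lia.
by rewrite natrB // ger0_norm // subr_ge0 ler_nat.
Qed.

Variant trunc_spec (t : R) : nat -> Prop :=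
| TruncInt i of t = i%:R : trunc_spec t i
| TruncFrac i of i%:R < t & t < i.+1%:R : trunc_spec t i.

Lemma truncP t : 0 <= t -> trunc_spec t (Num.trunc t).
Proof.
move=> t0; have /andP[] := truncn_itv t0; rewrite le_eqVlt => /orP[/eqP e _|].
  exact: TruncInt.
exact: TruncFrac.
Qed.

(** This treats vertices, edge points and both edge orientations alike, so that distances along the
    path become absolute values of differences with integers. *)
Lemma cell_ends_geo t p : 0 <= t <= (size w)%:R ->
  cell_ends (geo_path t) p <->
  exists j, [/\ (j <= size w)%N, `|t - j%:R| < 1 &
    p = (vertex_at j, `|t - j%:R|)].
Proof.
move=> /andP[t0 tw]; rewrite /geo_path.
case: truncP => // i.
  move=> ti; rewrite {1}ti subrr eqxx /=; split.
    move=> ->; exists i; rewrite ti subrr normr0; split => //.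
    by rewrite -(ler_nat R) -ti.
  move=> [j [jw]]; rewrite ti -ndistE => jt ->.
  have : (ndist i j < 1)%N by rewrite -(ltr_nat R).
  rewrite {jt} /ndist => jt; have -> : j = i by lia.
  by rewrite subnn.
move=> it ti.
have iw : (i < size w)%N by rewrite -(ltr_nat R) (lt_le_trans it).
have ti' : t < i%:R + 1 by rewrite natr1.
have -> : (t - i%:R == 0) = false by apply/negbTE; lra.
have iS : (i.+1)%:R = i%:R + 1 :> R by rewrite -natr1.
have n0 : `|t - i%:R| = t - i%:R by rewrite ger0_norm //; lra.
have n1 : `|t - i.+1%:R| = 1 - (t - i%:R) by rewrite iS ler0_norm; lra.
have two : (exists j, [/\ (j <= size w)%N, `|t - j%:R| < 1 &
    p = (vertex_at j, `|t - j%:R|)]) <->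
    p = (vertex_at i, t - i%:R) \/ p = (vertex_at i.+1, 1 - (t - i%:R)).
  split.
    move=> [j [jw jt ->]].
    have [/eqP e|/eqP e] : j == i \/ j == i.+1.
      move: jt; rewrite ltr_norml => /andP[j1 j2].
      have h1 : (j%:R < i.+2%:R :> R) by rewrite -!natr1; lra.
      have h2 : (i%:R < j.+1%:R :> R) by rewrite -!natr1; lra.
      move: h1 h2; rewrite !ltr_nat; lia.
    - by left; rewrite e n0.
    - by right; rewrite e n1.
  move=> [->|->]; [exists i|exists i.+1]; rewrite ?n0 ?n1; split => //.
  - exact: ltnW.
  - lra.
  - lra.
apply: (iff_trans _ (iff_sym two)).
have vS := vertex_atS iw.
case: (nth (1%g, false) w i) vS => s [] /= vS.
  have -> : (vertex_at i.+1 * s)%g = vertex_at i.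
    by rewrite vS /letter_val /= mulgVK.
  have -> : 1 - (1 - (t - i%:R)) = t - i%:R by lra.
  by split => [[]->|[]->]; [right|left|right|left].
have -> : (vertex_at i * s)%g = vertex_at i.+1 by rewrite vS.
by [].
Qed.

Lemma geo_path_int (i : nat) : geo_path i%:R = Vertex (vertex_at i).
Proof. by rewrite /geo_path natrK subrr eqxx. Qed.

Lemma nth_word_over i : (i < size w)%N -> S (nth (1%g, false) w i).1.
Proof. by move=> iw; apply/Sw/mem_nth. Qed.

Lemma geo_path_in t : 0 <= t <= (size w)%:R -> cayley_graph S (geo_path t).
Proof.
move=> /andP[t0 tw]; rewrite /geo_path.
case: truncP => // i.
  by move=> ti; rewrite {1}ti subrr eqxx.
move=> it; rewrite -natr1 => ti.
have iw : (i < size w)%N by rewrite -(ltr_nat R) (lt_le_trans it).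
have -> : (t - i%:R == 0) = false by apply/negbTE; lra.
by case: (nth _ w i) (nth_word_over iw) => s [] /= Ss; split => //; lra.
Qed.

Lemma path_length_geo t u : 0 <= t <= (size w)%:R -> 0 <= u <= (size w)%:R ->
  forall i j, (i <= size w)%N -> (j <= size w)%N ->
  `|t - i%:R| < 1 -> `|u - j%:R| < 1 ->
  path_lengths S (geo_path t) (geo_path u)
    (`|t - i%:R| + `|i%:R - j%:R| + `|u - j%:R|).
Proof.
move=> tw uw i j iw jw ti uj; left.
have [v [Sv vv sv]] := wlenP genS ((vertex_at i)^-1 * vertex_at j)%g.
exists (vertex_at i, `|t - i%:R|), (vertex_at j, `|u - j%:R|), v; split => //=.
- by apply/(cell_ends_geo _ tw); exists i.
- by apply/(cell_ends_geo _ uw); exists j.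
- by rewrite vv mulVKg.
- by rewrite sv -/(wdist _ _) wdist_vertex_atE // ndistE.
Qed.

Lemma vertex_at_inj i j : (i <= size w)%N -> (j <= size w)%N ->
  vertex_at i = vertex_at j -> i = j.
Proof.
move=> iw jw e; have := wdist_vertex_atE iw jw.
by rewrite e wdistxx /ndist; lia.
Qed.

Lemma dist_le_path_length t u l :
  0 <= t <= (size w)%:R -> 0 <= u <= (size w)%:R ->
  path_lengths S (geo_path t) (geo_path u) l -> `|t - u| <= l.
Proof.
move=> tw uw [[a [b [v [/(cell_ends_geo _ tw)[i [iw ti ->]]
  /(cell_ends_geo _ uw)[j [jw uj ->]] Sv /= vE ->]]]]|].
  have le_v : `|i%:R - j%:R| <= (size v)%:R :> R.
    rewrite -ndistE ler_nat -wdist_vertex_atE // -vE.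
    by rewrite /wdist mulKg wlen_le.
  have := ler_normD (t - i%:R) (i%:R - j%:R).
  have := ler_normD (t - i%:R + (i%:R - j%:R)) (j%:R - u).
  have -> : t - i%:R + (i%:R - j%:R) + (j%:R - u) = t - u by ring.
  rewrite (distrC j%:R u); lra.
move=> [h [s [t' [u' [+ + ->]]]]].
move: tw uw => /andP[t0 tw] /andP[u0 uw]; rewrite /geo_path.
case: truncP => // i; first by move=> ti; rewrite {1}ti subrr eqxx.
move=> it; rewrite -natr1 => ti.
case: truncP => // j; first by move=> uj; rewrite {1}uj subrr eqxx.
move=> ju; rewrite -natr1 => uj.
have iw : (i < size w)%N by rewrite -(ltr_nat R) (lt_le_trans it).
have jw : (j < size w)%N by rewrite -(ltr_nat R) (lt_le_trans ju).
have -> : (t - i%:R == 0) = false by apply/negbTE; lra.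
have -> : (u - j%:R == 0) = false by apply/negbTE; lra.
have viS := vertex_atS iw; have vjS := vertex_atS jw.
(* An edge traversed in opposite directions would force both [j = i + 1] and [i = j + 1], because
   the vertices of a geodesic are distinct; equal directions give [i = j]. *)
case: (nth _ w i) viS => s1 [] /= viS; case: (nth _ w j) vjS => s2 [] /= vjS.
- move=> [<- _ <-] [/vertex_at_inj e _ <-].
  have [ij] : j.+1 = i.+1 by apply: e.
  rewrite ij le_eqVlt; apply/orP; left; apply/eqP.
  by rewrite distrC; congr `|_|; ring.
- move=> [<- <- <-] [e1 e2 <-]; exfalso.
  have := vertex_at_inj (ltnW jw) iw e1.
  have e3 : vertex_at j.+1 = vertex_at i.
    by rewrite vjS e1 e2 viS /letter_val /= mulgVK.
  by have := vertex_at_inj jw (ltnW iw) e3; lia.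
- move=> [<- <- <-] [e1 e2 <-]; exfalso.
  have := vertex_at_inj jw (ltnW iw) e1.
  have e3 : vertex_at j = vertex_at i.+1.
    by rewrite viS -e1 -e2 vjS /letter_val /= mulgVK.
  by have := vertex_at_inj (ltnW jw) iw e3; lia.
- move=> [<- _ <-] [/vertex_at_inj e _ <-].
  have ij : j = i by apply: e; exact: ltnW.
  by rewrite ij; rewrite le_eqVlt; apply/orP; left; apply/eqP; congr `|_|; ring.
Qed.

Lemma path_lengths_sym p q (l : R) :
  path_lengths S p q l -> path_lengths S q p l.
Proof.
case=> [[a [b [v [pa qb Sv vE ->]]]]|[h [s [t [u [-> -> ->]]]]]].
  left; exists b, a, (inv_word v); split => //.
  - exact: word_over_inv.
  - by rewrite -vE word_val_inv mulgK.
  - by rewrite /inv_word size_rev size_map; ring.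
by right; exists h, s, u, t; rewrite distrC.
Qed.

(** For [t <= u], leave through the first vertex at or after [t] and enter through the last vertex
    at or before [u]; if no vertex separates them, both points lie on one open edge. *)
Lemma path_length_dist t u :
  0 <= t <= (size w)%:R -> 0 <= u <= (size w)%:R ->
  path_lengths S (geo_path t) (geo_path u) `|t - u|.
Proof.
wlog tu : t u / t <= u.
  move=> H tw uw; have [/H|/ltW /H] := leP t u; first exact.
  by move=> /(_ uw tw) /path_lengths_sym; rewrite distrC.
move=> tw uw; have := path_length_geo tw uw.
move: (tw) (uw) => /andP[t0 tw'] /andP[u0 uw'].
have /andP[ju uj] := truncn_itv u0; set j := Num.trunc u in ju uj *.
have jw : (j <= size w)%N by rewrite -(ler_nat R) (le_trans ju).
have uj1 : `|u - j%:R| = u - j%:R by rewrite ger0_norm //; lra.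
have uj2 : `|u - j%:R| < 1 by move: uj; rewrite uj1 -natr1; lra.
have dtu : `|t - u| = u - t by rewrite distrC ger0_norm //; lra.
case: (truncP t0) => i.
  move=> ti /(_ i j).
  have iw : (i <= size w)%N by rewrite -(ler_nat R) -ti.
  have ij : (i <= j)%N.
    by rewrite -ltnS -(ltr_nat R) (le_lt_trans _ uj) // -ti.
  have ti0 : `|t - i%:R| = 0 by rewrite ti subrr normr0.
  move=> /(_ iw jw); rewrite ti0 ltr01 => /(_ erefl uj2).
  rewrite -ndistE ndist_le // natrB // uj1 dtu.
  by rewrite (_ : 0 + _ + _ = u - t); last by rewrite ti; ring.
move=> it ti; have [iu|ui] := leP i.+1%:R u.
  have iw : (i.+1 <= size w)%N by rewrite -(ler_nat R) (le_trans iu).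
  have ij : (i.+1 <= j)%N by rewrite -ltnS -(ltr_nat R) (le_lt_trans iu).
  have ti1 : `|t - i.+1%:R| = i.+1%:R - t.
    by rewrite distrC ger0_norm //; lra.
  have ti2 : `|t - i.+1%:R| < 1 by rewrite ti1 -natr1; lra.
  move=> /(_ _ _ iw jw ti2 uj2); rewrite ti1 uj1 -ndistE.
  rewrite ndist_le // natrB // dtu.
  by rewrite (_ : i.+1%:R - t + _ + _ = u - t); last by ring.
move=> _; right; rewrite /geo_path.
have -> : Num.trunc t = i by apply: truncn_def; rewrite ltW.
have -> : Num.trunc u = i by apply: truncn_def; rewrite ui (le_trans (ltW it)).
have -> : (t - i%:R == 0) = false by apply/negbTE; lra.
have -> : (u - i%:R == 0) = false by apply/negbTE; lra.
case: (nth _ w i) => s [] /=; do 4 eexists; split; try reflexivity.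
  by rewrite distrC; congr `|_|; ring.
by congr `|_|; ring.
Qed.

Lemma geo_path_geodesic : geodesic S (size w)%:R geo_path.
Proof.
split; [by []|exact: geo_path_in|move=> t u tw uw].
have PL := path_length_dist tw uw; apply/eqP; rewrite eq_le; apply/andP; split.
  apply: ge_inf PL; exists 0 => l /(dist_le_path_length tw uw).
  exact: le_trans.
apply: lb_le_inf; first by exists `|t - u|.
by move=> l /(dist_le_path_length tw uw).
Qed.

(** The extra 1 leaves room to pick an actual path length close to the infimum. That path enters the
    cell of the geodesic through one of its vertices, so moving from an edge point to a vertex costs
    nothing more. *)
Lemma trace_geo_path p e :
  neighborhood S e (trace (size w)%:R geo_path) (Vertex p) ->
  exists2 i, (i <= size w)%N & (wdist p (vertex_at i))%:R < e + 1.
Proof.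
case=> q [t tw <-] le_e.
have [l Pl le_l] :
    exists2 l, path_lengths S (Vertex p) (geo_path t) l & l < e + 1.
  have : inf (path_lengths S (Vertex p) (geo_path t)) < e + 1.
    by apply: le_lt_trans le_e _; lra.
  have [i [b [iw tb]]] : exists i b, (i <= size w)%N /\
    cell_ends (geo_path t) (vertex_at i, b).
    have /andP[t0 tn] := tw; have /andP[it ti] := truncn_itv t0.
    move: it ti; set i := Num.trunc t => it ti.
    have iw : (i <= size w)%N by rewrite -(ler_nat R) (le_trans it).
    exists i, `|t - i%:R|; split => //; apply/(cell_ends_geo _ tw).
    exists i; split => //; rewrite ger0_norm; last by lra.
    by move: ti; rewrite -natr1; lra.
  apply: inf_lt.
  have [v [Sv vv sv]] := wlenP genS (p^-1 * vertex_at i)%g.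
  exists (0 + (size v)%:R + b); left.
  by exists (p, 0), (vertex_at i, b), v; split => //=; rewrite vv mulVKg.
case: Pl => [[a [b [v [-> /(cell_ends_geo _ tw)[i [iw ti ->]] Sv /= vE lE]]]]|].
  exists i => //; apply: le_lt_trans le_l; rewrite lE.
  have : ((wdist p (vertex_at i))%:R <= (size v)%:R :> R).
    by rewrite ler_nat -vE /wdist mulKg wlen_le.
  by have := normr_ge0 (t - i%:R); lra.
by move=> [h [s [t' [u' []]]]].
Qed.
End CayleyGeodesics.

(** * Integer forms of thin triangles and quasiconvexity *)

Section DiscreteGeometry.
Variables (R : realType) (G : groupType) (S : set G).
Hypothesis genS : generates S.
Local Notation dist := (wdist S).

Definition between (a b p : G) : Prop := (dist a p + dist p b = dist a b)%N.

Lemma between_path a b p : between a b p ->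
  exists w, [/\ word_over S w, (a * word_val id w)%g = b,
    size w = wlen S (word_val id w) &
    exists2 i, (i <= size w)%N & vertex_at a w i = p].
Proof.
move=> ab; have [u [Su ua su]] := wlenP genS (a^-1 * p)%g.
have [v [Sv vb sv]] := wlenP genS (p^-1 * b)%g.
have uvE : word_val id (u ++ v) = (a^-1 * b)%g.
  by rewrite word_val_cat ua vb -mulgA mulVKg.
exists (u ++ v); split.
- exact: word_over_cat.
- by rewrite uvE mulVKg.
- by rewrite uvE size_cat su sv.
exists (size u); first by rewrite size_cat leq_addr.
by rewrite /vertex_at take_size_cat // ua mulVKg.
Qed.

Lemma vertex_at_between a w i : word_over S w ->
  size w = wlen S (word_val id w) -> (i <= size w)%N ->
  between a (a * word_val id w)%g (vertex_at a w i).
Proof.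
move=> Sw geo iw; rewrite /between -vertex_at_size.
have d j l : (j <= l <= size w)%N ->
    dist (vertex_at a w j) (vertex_at a w l) = (l - j)%N.
  exact: wdist_vertex_at.
have := d 0%N i; have := d i (size w); have := d 0%N (size w).
rewrite vertex_at0 iw leqnn /= => -> // -> // -> //; lia.
Qed.

Lemma discrete_thin (delta : R) : thin_triangles S delta ->
  exists D, forall a b c p, between a b p ->
    exists2 q, (dist p q <= D)%N & between b c q \/ between c a q.
Proof.
move=> thin; exists (Num.trunc (delta + 1)) => a b c p.
move=> /between_path[u [Su uE gu [i iu pE]]].
(* Any geodesic from [b] to [c] will do; the trivial betweenness of an endpoint supplies one. The
   third side is obtained in the same way. *)
have [|v [Sv vE gv _]] := @between_path b c b.
  by rewrite /between wdistxx.
have [|w [Sw wE gw _]] := @between_path c a c.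
  by rewrite /between wdistxx.
have [] := thin _ _ _ _ _ _ (geo_path_geodesic R genS a Su gu)
  (geo_path_geodesic R genS b Sv gv) (geo_path_geodesic R genS c Sw gw).
- by rewrite (geo_path_int _ _ _ 0) geo_path_int vertex_at_size vertex_at0 uE.
- by rewrite (geo_path_int _ _ _ 0) geo_path_int vertex_at_size vertex_at0 vE.
- by rewrite (geo_path_int _ _ _ 0) geo_path_int vertex_at_size vertex_at0 wE.
move=> /(_ (Vertex p)) thin1 _ _.
have close q : (dist p q)%:R < delta + 1 ->
    (dist p q <= Num.trunc (delta + 1))%N.
  move=> lt_q; rewrite truncn_ge_nat; first exact: ltW.
  exact: le_trans (ler0n _ _) (ltW lt_q).
case: thin1.
- by exists i%:R; rewrite ?geo_path_int ?pE //= ler0n ler_nat.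
- move=> q [qv|qw] le_q.
  + have [|j jv /close le_pj] := @trace_geo_path R G S genS b v gv p delta.
      by exists q.
    exists (vertex_at b v j) => //; left; rewrite -vE.
    exact: vertex_at_between.
  + have [|j jw /close le_pj] := @trace_geo_path R G S genS c w gw p delta.
      by exists q.
    exists (vertex_at c w j) => //; right; rewrite -wE.
    exact: vertex_at_between.
Qed.

Lemma discrete_quasiconvex (H : groupClosed G) :
  quasiconvex R H -> finite_set S ->
  exists D, forall a b p, a \in H -> b \in H -> between a b p ->
    exists2 h, h \in H & (dist p h <= D)%N.
Proof.
move=> qc finS; have [e e0 He] := qc S (conj finS genS).
exists (Num.trunc (e + 1)) => a b p aH bH /between_path[u [Su uE gu [i iu pE]]].
have [|||_ [h hH <-] le_e] :=
  He _ _ (geo_path_geodesic R genS a Su gu) _ _ (Vertex p).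
- by exists a => //; rewrite (geo_path_int _ _ _ 0) vertex_at0.
- by exists b => //; rewrite geo_path_int vertex_at_size uE.
- by exists i%:R; [rewrite /= ler0n ler_nat|rewrite geo_path_int pE].
exists h => //.
have [l Pl le_l] :
    exists2 l, path_lengths S (Vertex p) (Vertex h) l & l < e + 1.
  apply: inf_lt; last by apply: le_lt_trans le_e _; lra.
  have [v [Sv vv sv]] := wlenP genS (p^-1 * h)%g.
  exists (0 + (size v)%:R + 0); left.
  by exists (p, 0), (h, 0), v; split => //=; rewrite vv mulVKg.
rewrite truncn_ge_nat; last by lra.
apply: le_trans (ltW le_l).
case: Pl => [[a' [b' [v [-> -> Sv /= vE ->]]]]|[? [? [? [? []]]]] //].
by rewrite addr0 add0r ler_nat -vE /wdist mulKg wlen_le.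
Qed.
End DiscreteGeometry.

(** * Gromov products *)

Section FourPoint.
Local Open Scope nat_scope.
Variables (G : groupType) (S : set G).
Hypothesis genS : generates S.
Local Notation dist := (wdist S).
Variable D : nat.
Hypothesis thin : forall a b c p, between S a b p ->
  exists2 q, dist p q <= D & between S b c q \/ between S c a q.

Lemma close_between (b c p q : G) (n : nat) : between S b c q ->
  dist p q <= n -> dist b p + dist p c <= dist b c + n.*2.
Proof.
rewrite /between => bcq pq.
have := wdist_triangle genS q b p; have := wdist_triangle genS q p c.
rewrite (wdistC genS q p) -mul2n; move: bcq pq; lia.
Qed.

(* Along a geodesic from [b] to [c], the points near [c a] and the points
   near [a b] must be adjacent somewhere. *)
Lemma gromov_product_attained (a b c : G) : exists2 p, between S b c p &
  (dist a p).*2 + dist b c <= dist a b + dist a c + (4 * D + 2).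
Proof.
have [|w [Sw wE gw _]] := @between_path G S genS b c b.
  by rewrite /between wdistxx.
pose v := vertex_at b w.
have bcv i : i <= size w -> between S b c (v i).
  by rewrite -wE; apply: vertex_at_between.
pose near i := `[< exists2 q, dist (v i) q <= D & between S c a q >].
have ex_near : exists i, near i.
  exists (size w); apply/asboolP; exists c; last first.
    by rewrite /between wdistxx.
  by rewrite /v vertex_at_size wE wdistxx.
have [i /asboolP[q pq caq] mini] := ex_minnP ex_near.
have iw : i <= size w.
  apply: mini; apply/asboolP; exists c; last by rewrite /between wdistxx.
  by rewrite /v vertex_at_size wE wdistxx.
exists (v i); first exact: bcv.
(* By minimality of [i] the preceding vertex is not near a geodesic from [c] to [a], hence it is
   near one from [a] to [b]; the edge leading to [v i] accounts for the 1. For [i = 0] the vertex is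
   [b] itself. *)
have [q' pq' abq'] : exists2 q', dist (v i) q' <= D + 1 & between S a b q'.
  case: i iw mini {pq} => [|i] iw mini.
    exists b; last by rewrite /between wdistxx ?addn0.
    by rewrite /v vertex_at0 wdistxx.
  have [q' pq' [caq'|abq']] := thin a (bcv i (ltnW iw)).
    have : near i by apply/asboolP; exists q'.
    by move=> /mini; rewrite ltnn.
  exists q' => //.
  have dv : dist (v i.+1) (v i) = 1.
    by rewrite wdistC // (wdist_vertex_at genS) ?leqnSn // subSnn.
  by have := wdist_triangle genS (v i) (v i.+1) q'; rewrite dv; lia.
have := close_between caq pq; have := close_between abq' pq'.
have := bcv _ iw; rewrite /between.
rewrite (wdistC genS c (v i)) (wdistC genS (v i) a) (wdistC genS c a).
by rewrite (wdistC genS (v i) b) -!mul2n; lia.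
Qed.

Lemma gromov_product_le (a b c p : G) : between S b c p ->
  dist a b + dist a c <= (dist a p).*2 + dist b c.
Proof.
have := wdist_triangle genS p a b; have := wdist_triangle genS p a c.
by rewrite /between (wdistC genS p b) -mul2n; lia.
Qed.

(** The point of [[b, c]] whose distance to [a] is about the Gromov product of [b] and [c] at [a] is
    near [[c, d]] or [[d, b]]. The distance from [a] to a point of a geodesic is at least the Gromov
    product of its ends, so one of the other two products at [a] is not much larger. *)
Lemma four_point (a b c d : G) :
  dist a d + dist b c <= dist a c + dist b d + (6 * D + 2) \/
  dist a d + dist b c <= dist a b + dist d c + (6 * D + 2).
Proof.
have [p bcp le_p] := gromov_product_attained a b c.
have [q pq [cdq|dbq]] := thin d bcp; [right|left].
  have := gromov_product_le a cdq; have := wdist_triangle genS p a q.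
  by rewrite (wdistC genS d c) -mul2n; move: le_p; rewrite -mul2n; lia.
have := gromov_product_le a dbq; have := wdist_triangle genS p a q.
by rewrite (wdistC genS b d) -mul2n; move: le_p; rewrite -mul2n; lia.
Qed.

(** The witness is a point of [H] close to the point of [[b, c]] that realizes the Gromov product.
    The drift argument uses quasiconvexity in this form only. *)
Lemma quasiconvex_gromov_product (H : groupClosed G) (E : nat) (a b c : G) :
  (forall b c p, b \in H -> c \in H -> between S b c p ->
    exists2 h, h \in H & dist p h <= E) ->
  b \in H -> c \in H -> exists2 h, h \in H &
  (dist a h).*2 + dist b c <= dist a b + dist a c + (4 * D + 2 + E.*2).
Proof.
move=> qc bH cH; have [p bcp le_p] := gromov_product_attained a b c.
have [h hH ph] := qc _ _ _ bH cH bcp; exists h => //.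
have := wdist_triangle genS p a h; move: le_p ph; rewrite -!mul2n; lia.
Qed.
End FourPoint.

(** * Loxodromic elements *)

(* The same product may be elaborated through several structures of [G], and
   [lia] distinguishes the resulting terms. *)
Ltac group_canon G :=
  repeat match goal with
  | |- context [@monoid.mul ?M] =>
      lazymatch M with
      | monoid_Group__to__monoid_Magma G => fail
      | _ => change (@monoid.mul M)
               with (@monoid.mul (monoid_Group__to__monoid_Magma G))
      end
  | |- context [@natexp ?M] =>
      lazymatch M with
      | monoid_Group__to__monoid_BaseUMagma G => fail
      | _ => change (@natexp M)
               with (@natexp (monoid_Group__to__monoid_BaseUMagma G))
      end
  | |- context [@one ?M] =>
      lazymatch M with
      | monoid_Group__to__monoid_BaseUMagma G => fail
      | _ => change (@one M)
               with (@one (monoid_Group__to__monoid_BaseUMagma G))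
      end
  | |- context [@monoid.inv ?M] =>
      lazymatch M with
      | monoid_Group__to__monoid_BaseGroup G => fail
      | _ => change (@monoid.inv M)
               with (@monoid.inv (monoid_Group__to__monoid_BaseGroup G))
      end
  | H : context [@monoid.mul ?M] |- _ =>
      lazymatch M with
      | monoid_Group__to__monoid_Magma G => fail
      | _ => change (@monoid.mul M)
               with (@monoid.mul (monoid_Group__to__monoid_Magma G)) in H
      end
  | H : context [@natexp ?M] |- _ =>
      lazymatch M with
      | monoid_Group__to__monoid_BaseUMagma G => fail
      | _ => change (@natexp M)
               with (@natexp (monoid_Group__to__monoid_BaseUMagma G)) in H
      end
  | H : context [@one ?M] |- _ =>
      lazymatch M with
      | monoid_Group__to__monoid_BaseUMagma G => fail
      | _ => change (@one M)
               with (@one (monoid_Group__to__monoid_BaseUMagma G)) in H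
      end
  | H : context [@monoid.inv ?M] |- _ =>
      lazymatch M with
      | monoid_Group__to__monoid_BaseGroup G => fail
      | _ => change (@monoid.inv M)
               with (@monoid.inv (monoid_Group__to__monoid_BaseGroup G)) in H
      end
  end.

Section Loxodromic.
Local Open Scope nat_scope.
Variables (G : groupType) (S : set G).
Hypothesis genS : generates S.
Local Notation len := (wlen S).
Local Notation dist := (wdist S).
Variable K : nat.
Hypothesis four_pt : forall a b c d,
  dist a d + dist b c <= dist a c + dist b d + K \/
  dist a d + dist b c <= dist a b + dist d c + K.

(* Twice the Gromov product of [x] and [y] at [1], which keeps it integral. *)
Definition gprod (x y : G) : nat := len x + len y - len (x^-1 * y)%g.

Local Notation group_norm := (@mulgA G, @invgM G, @invgK G, @mulgK G,
  @mulgVK G, @mulVg G, @mulgV G, @mul1g G, @mulg1 G, @invg1 G).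

Local Ltac glia := group_canon G; lia.

Lemma len_mulV (x y : G) : len (x^-1 * y)%g <= len x + len y.
Proof. by rewrite -(wlenV genS x) wlenM. Qed.

Lemma len_sub (x y : G) : len x <= len y + len (x^-1 * y)%g.
Proof.
have := wlenM genS y (x^-1 * y)^-1%g.
by rewrite wlenV // !group_norm.
Qed.

Lemma gprodE (x y : G) : gprod x y + len (x^-1 * y)%g = len x + len y.
Proof. by rewrite /gprod subnK // len_mulV. Qed.

Lemma gprodC (x y : G) : gprod x y = gprod y x.
Proof.
by rewrite /gprod addnC -(wlenV genS (x^-1 * y)%g) !group_norm.
Qed.

Lemma gprod_le (x y : G) : gprod x y <= (len x).*2.
Proof.
have := gprodE x y; have := len_sub y x.
rewrite -(wlenV genS (x^-1 * y)%g) !group_norm -mul2n.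
glia.
Qed.

Lemma gprod_hyp (z x y : G) :
  gprod x z <= gprod x y + K \/ gprod z y <= gprod x y + K.
Proof.
have := gprodE x z; have := gprodE z y; have := gprodE x y.
have := four_pt 1%g x y z; rewrite /wdist !group_norm.
glia.
Qed.


(** Seen from its midpoint, a geodesic of length [2L] has ends [x] and [y] with Gromov product 0. If
    neither has a long square, each of them starts out like its own inverse. Then [x * y] starts out
    like [x], and its inverse like [y^-1], hence like [y], so little cancels in its square. *)
Lemma unbounded_len_loxodromic (A : nat) :
  (forall n, exists g, n <= len g) ->
  exists g, len g + A <= len (g * g)%g.
Proof.
move=> unb; pose L := A + 6 * K + 1.
have [x [y [xL yL xyL]]] :
    exists x y, [/\ len x = L, len y = L & len (x^-1 * y)%g = L.*2].
  have [g0 /(wlen_split genS)[g [gL _]]] := unb L.*2.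
  have Lg : L <= len g by rewrite gL -mul2n; glia.
  have [p [pL pg]] := wlen_split genS Lg.
  exists p^-1%g, (p^-1 * g)%g; rewrite wlenV //; split => //.
    by rewrite pg gL -mul2n; glia.
  by rewrite !group_norm.
move: xyL; rewrite -mul2n => xyL.
have := gprodE x y; rewrite xL yL xyL => xy.
have := gprodE x^-1%g x; rewrite invgK (wlenV genS) => xx.
have [?|xV] := leqP (gprod x^-1%g x + A) L; first by exists x; glia.
have := gprodE y^-1%g y; rewrite invgK (wlenV genS) => yy.
have [?|yV] := leqP (gprod y^-1%g y + A) L; first by exists y; glia.
exists (x * y)%g; set h := (x * y)%g.
have hx := gprodE x^-1%g y; rewrite invgK (wlenV genS) -/h in hx.
have xh : gprod x h = len h + L - L.
  by rewrite /gprod /h !group_norm xL yL; glia.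
have yh : gprod h^-1%g y^-1%g = len h + L - L.
  by rewrite /gprod /h !group_norm -(invgM x y) !(wlenV genS) xL yL; glia.
have := gprodE h^-1%g h; rewrite invgK (wlenV genS) => hh.
have := gprod_hyp x^-1%g x y; have := gprod_hyp y^-1%g x y.
have := gprod_hyp h x h^-1%g; have := gprod_hyp h^-1%g x y^-1%g.
rewrite (gprodC x x^-1%g) (gprodC h h^-1%g).
by move: xV yV; rewrite /L in xL yL xy hx xh yh xx yy *; glia.
Qed.

Section Axis.
Variables (g : G) (A : nat).
Hypothesis KA : 3 * K < A.
Hypothesis gA : len g + A <= len (g * g)%g.

(** Apply the four-point condition to [1], [g], [g ^ (n+2)] and [g ^ 2]: one alternative is the next
    step, and the other contradicts the induction hypothesis together with [gA]. *)
Lemma loxodromic_step n : len (g ^+ n)%g + (A - K) <= len (g ^+ n.+1)%g.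
Proof.
elim: n => [|n IH].
  by rewrite expg0 expg1 wlen1; have := wlenM genS g g; glia.
have := four_pt 1%g g (g ^+ n.+2)%g (g * g)%g; rewrite /wdist invg1 !mul1g.
have -> : (g^-1 * g ^+ n.+2 = g ^+ n.+1)%g by rewrite expgS mulKg.
have -> : ((g * g)^-1 * g ^+ n.+2 = g ^+ n)%g.
  by rewrite !expgS invgM -!mulgA !mulKg.
by rewrite mulKg; move: IH; glia.
Qed.

Lemma loxodromic_len_ge n : n <= len (g ^+ n)%g.
Proof. by elim: n => [//|n IH]; have := loxodromic_step n; glia. Qed.

Lemma loxodromic_len_mono m n : m <= n -> len (g ^+ m)%g <= len (g ^+ n)%g.
Proof.
elim: n => [|n IH]; first by rewrite leqn0 => /eqP->.
rewrite leq_eqVlt => /orP[/eqP->//|/IH]; have := loxodromic_step n; glia.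
Qed.

Lemma gprod1g x : gprod 1%g x = 0.
Proof. by rewrite /gprod wlen1 // invg1 mul1g subnn. Qed.

(** Nontrivial positive powers start out like [g] and negative ones like [g^-1], whereas [gA] makes
    the product of [g] and [g^-1] small; two uses of hyperbolicity transfer this to the powers. *)
Lemma loxodromic_gprod n m : gprod (g ^+ n)%g (g ^- m)%g <= len g.
Proof.
case: n => [|n]; first by rewrite expg0 gprod1g.
case: m => [|m]; first by rewrite expg0 invg1 gprodC gprod1g.
have a1 : gprod g (g ^+ n.+1)%g + len (g ^+ n)%g = len g + len (g ^+ n.+1)%g.
  by rewrite -gprodE; congr (_ + len _); rewrite expgS mulKg.
have a2 : gprod (g ^- m.+1)%g g^-1%g + len (g ^+ m)%g =
    len g + len (g ^+ m.+1)%g.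
  have := gprodE (g ^- m.+1)%g g^-1%g; rewrite invgK !(wlenV genS).
  have -> : (g ^+ m.+1 * g^-1 = g ^+ m)%g by rewrite expgSr mulgK.
  glia.
have a3 : gprod g g^-1%g + len (g * g)%g = len g + len g.
  by have := gprodE g g^-1%g; rewrite -invgM !(wlenV genS).
have := gprod_hyp (g ^+ n.+1)%g g g^-1%g.
have := gprod_hyp (g ^- m.+1)%g (g ^+ n.+1)%g g^-1%g.
have := loxodromic_step n; have := loxodromic_step m.
by move: a1 a2 a3; glia.
Qed.
End Axis.

End Loxodromic.

(** * Fellow-travelling of two axes *)

Section FellowTravel.
Local Open Scope nat_scope.
Variables (G : groupType) (S : set G).
Hypothesis genS : generates S.
Local Notation len := (wlen S).
Local Notation dist := (wdist S).
Local Notation gprod := (gprod S).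
Variable K : nat.
Hypothesis four_pt : forall a b c d,
  dist a d + dist b c <= dist a c + dist b d + K \/
  dist a d + dist b c <= dist a b + dist d c + K.
Local Notation group_norm := (@mulgA G, @invgM G, @invgK G, @mulgK G,
  @mulgVK G, @mulVg G, @mulgV G, @mul1g G, @mulg1 G, @invg1 G).
Local Ltac glia := group_canon G; lia.

Definition axis (C : nat) (g : G) : Prop :=
  [/\ forall n, n <= len (g ^+ n)%g,
      forall m n, m <= n -> len (g ^+ m)%g <= len (g ^+ n)%g &
      forall n m, gprod (g ^+ n)%g (g ^- m)%g <= C].

Lemma axisV C g : axis C g -> axis C g^-1%g.
Proof.
move=> [g1 g2 g3]; split => [n|m n mn|n m].
- by rewrite expVgn (wlenV genS).
- by rewrite !expVgn !(wlenV genS) g2.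
- by rewrite !expVgn invgK gprodC.
Qed.

Lemma len_expg_le n (g : G) : len (g ^+ n)%g <= n * len g.
Proof.
elim: n => [|n IH]; first by rewrite expg0 wlen1.
by rewrite expgS mulSn (leq_trans (wlenM genS _ _)) // leq_add2l.
Qed.

Variables (C : nat) (a b : G).
Hypotheses (axa : axis C a) (axb : axis C b).

(** The witness is the first [j] for which [s b^j] is at least as far from 1 as [a^i]; it overshoots
    by at most [len b]. The lower bound on [len (a^i)] ensures that [s b^j] lies near a geodesic
    from 1 to [s b^m], in spite of the detour through [s]. *)
Lemma fellow_point (s : G) (i n m : nat) :
  2 * len s + C + K < len (a ^+ i)%g ->
  2 * len (a ^+ i)%g < gprod (a ^+ n)%g (s * b ^+ m)%g ->
  exists j, len (a ^- i * (s * b ^+ j))%g <= len b + C + 3 * K.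
Proof.
move=> si ilt; have [_ a2 a3] := axa; have [_ b2 b3] := axb.
have lei : i <= n.
  rewrite leqNgt; apply/negP => /ltnW/a2.
  by have := gprod_le genS (a ^+ n)%g (s * b ^+ m)%g; rewrite -mul2n; glia.
have lem : len (a ^+ i)%g <= len (s * b ^+ m)%g.
  have := gprod_le genS (s * b ^+ m)%g (a ^+ n)%g.
  by rewrite gprodC // -mul2n; glia.
have ex_j : exists j, len (a ^+ i)%g <= len (s * b ^+ j)%g by exists m.
have [j jP minj] := ex_minnP ex_j.
have jm : j <= m by exact: minj.
have jle : len (s * b ^+ j)%g <= len (a ^+ i)%g + len b.
  case: j jP minj {jm} => [|j] jP minj; first by rewrite expg0 mulg1; lia.
  have : ~~ (len (a ^+ i)%g <= len (s * b ^+ j)%g).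
    by apply/negP => /minj; rewrite ltnn.
  have := wlenM genS (s * b ^+ j)%g b; rewrite -mulgA -expgSr; glia.
exists j.
have d1 := gprodE genS (a ^+ i)%g (a ^+ n)%g.
have e1 : ((a ^+ i)^-1 * a ^+ n = a ^+ (n - i))%g.
  by rewrite -{1}(subnKC lei) expgnDr mulKg.
have d2 := gprodE genS (a ^+ (n - i))%g (a ^- i)%g.
have e2 : ((a ^+ (n - i))^-1 * a ^- i = a ^- n)%g.
  by rewrite -invgM -expgnDr subnKC.
rewrite e1 in d1; rewrite e2 !(wlenV genS) in d2.
have d3 := gprodE genS (s * b ^+ m)%g (s * b ^+ j)%g.
have e3 : ((s * b ^+ m)^-1 * (s * b ^+ j) = b ^- (m - j))%g.
  by rewrite -{1}(subnKC jm) expgnDr (mulgA s) invgM mulgVK.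
rewrite e3 (wlenV genS) in d3.
pose z := (b ^- j * s^-1)%g.
have lz : len z = len (s * b ^+ j)%g by rewrite /z -invgM (wlenV genS).
have d4 := gprodE genS z (b ^+ (m - j))%g.
have e4 : (z^-1 * b ^+ (m - j) = s * b ^+ m)%g.
  by rewrite /z !group_norm -mulgA -expgnDr subnKC.
rewrite e4 lz in d4.
have d5 := gprodE genS (b ^- j)%g z.
have e5 : ((b ^- j)^-1 * z = s^-1)%g by rewrite /z mulKg.
rewrite e5 !(wlenV genS) lz in d5.
have d6 := wlenM genS s^-1%g (s * b ^+ j)%g.
rewrite mulKg (wlenV genS) in d6.
have h1 := a3 (n - i) i.
have h2 := b3 (m - j) j.
have h3 := gprod_hyp genS four_pt z (b ^- j)%g (b ^+ (m - j))%g.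
have h4 := gprod_hyp genS four_pt (a ^+ n)%g (a ^+ i)%g (s * b ^+ j)%g.
have h5 := gprod_hyp genS four_pt (s * b ^+ m)%g (a ^+ n)%g (s * b ^+ j)%g.
have d7 := gprodE genS (a ^+ i)%g (s * b ^+ j)%g.
rewrite (gprodC genS (b ^- j)%g (b ^+ (m - j))%g) in h3.
clear e1 e2 e3 e4 e5 ex_j minj a2 a3 b2 b3 axa axb lz.
glia.
Qed.

Lemma cyclic_subgroupM (g y z : G) : cyclic_subgroup g y ->
  cyclic_subgroup g z -> cyclic_subgroup g (y * z)%g.
Proof.
have mix n m : cyclic_subgroup g (g ^+ n * g ^- m)%g.
  have [nm|/ltnW mn] := leqP m n.
    by exists (n - m); left; rewrite expgnFr.
  by exists (m - n); right; rewrite expgnFr // invgM invgK.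
move=> [n [->|->]] [m [->|->]].
- by exists (n + m); left; rewrite expgnDr.
- exact: mix.
- have -> : (g ^- n * g ^+ m = g ^+ m * g ^- n)%g; last exact: mix.
  apply: (@mulgI _ (g ^+ n)%g); rewrite mulVKg mulgA -expgnDr addnC expgnDr.
  by rewrite mulgK.
- by exists (m + n); right; rewrite expgnDr invgM.
Qed.

Lemma cyclic_subgroupV (g y : G) :
  cyclic_subgroup g y -> cyclic_subgroup g y^-1%g.
Proof. by move=> [n [->|->]]; exists n; [right|left; rewrite invgK]. Qed.

Lemma cyclic_subgroupX (g y : G) n :
  cyclic_subgroup g y -> cyclic_subgroup g (y ^+ n)%g.
Proof.
move=> gy; elim: n => [|n IH]; first by exists 0; left.
by rewrite expgS; refine (cyclic_subgroupM _ _).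
Qed.

Hypothesis finS : finite_set S.

(* If the axes of [a] and of [s b s^-1] fellow-travel for long, two of the
   finitely many possible small differences between them coincide, whence a
   relation [s b^e = a^l s] with bounded [e]; moving [s] along [b^e] brings it
   close to the cyclic group of [a]. *)
Lemma axes_diverge : exists Rad, forall s : G,
  (forall T, exists n m, T < gprod (a ^+ n)%g (s * b ^+ m)%g) ->
  exists y u : G, [/\ cyclic_subgroup a y, s = (y * u)%g & len u <= Rad].
Proof.
pose D := len b + C + 3 * K.
have [B BP] := wlen_ball_finite genS D finS.
pose M := size B; pose R1 := 2 * D + M * len a.
exists (D + R1 * len b) => s far.
have [a1 a2 _] := axa; have [b1 _ _] := axb.
(* As [n <= len (a ^+ n)], every exponent from [i0] on satisfies the length condition of
   [fellow_point]. *)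
pose i0 := (2 * len s + C + K).+1.
have near i : exists j, len (a ^- (i0 + i) * (s * b ^+ j))%g <= D.
  have [n [m nm]] := far (2 * len (a ^+ (i0 + i))%g).
  by apply: fellow_point nm; have := a1 (i0 + i); rewrite /i0; lia.
have {near} [j jP] := choice near.
pose c i := (a ^- (i0 + i) * (s * b ^+ j i))%g.
have : ~~ uniq (mkseq c M.+1).
  apply/negP => /uniq_leq_size -/(_ B); rewrite size_mkseq ltnn => H.
  by have : false by apply: H => y /mapP[i _ ->]; apply/BP/jP.
move=> /(uniqPn 1%g)[i [i' []]]; rewrite size_mkseq => ii' i'M.
rewrite !nth_mkseq //; last by lia.
move=> cE; pose l := i' - i.
have sb : (s * b ^+ j i' = a ^+ l * (s * b ^+ j i))%g.
  have -> : (s * b ^+ j i = a ^+ (i0 + i) * c i)%g by rewrite mulVKg.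
  rewrite cE mulgA -expgnDr (_ : l + (i0 + i) = i0 + i') ?mulVKg //.
  by rewrite /l; lia.
have lM : l <= M by rewrite /l; lia.
have l0 : 0 < l by rewrite /l; lia.
have lenl : len (a ^+ l)%g <= M * len a.
  by apply: leq_trans (len_expg_le _ _) _; rewrite leq_mul2r lM orbT.
have bb : len (b ^- (j i) * b ^+ (j i'))%g <= R1.
  have -> : (b ^- j i * b ^+ j i' = (c i)^-1 * (a ^+ l * c i))%g.
    rewrite -(mulKg s (b ^+ j i')%g) sb (mulgA (b ^- _)%g) -invgM.
    have -> : (s * b ^+ j i = a ^+ (i0 + i) * c i)%g by rewrite mulVKg.
    rewrite (mulgA (a ^+ l)%g) -expgnDr (addnC l) expgnDr.
    rewrite -(mulgA (a ^+ (i0 + i))%g) invgM.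
    by rewrite -(mulgA (c i)^-1%g) mulKg.
  have := wlenM genS (c i)^-1%g (a ^+ l * c i)%g.
  have := wlenM genS (a ^+ l)%g (c i); rewrite (wlenV genS).
  by have := jP i; rewrite -/(c i) /R1; move: lenl; glia.
have [e [y [e0 eR ay sbe]]] : exists e y, [/\ 0 < e, e <= R1,
    cyclic_subgroup a y & (s * b ^+ e = y * s)%g].
  have [lt_j|lt_j|eq_j] := ltngtP (j i) (j i').
  - exists (j i' - j i), (a ^+ l)%g; split; [lia| |by exists l; left|].
      apply: leq_trans (b1 _) _; move: bb.
      by rewrite -{1}(subnKC (ltnW lt_j)) expgnDr mulKg.
    apply: (@mulIg _ (b ^+ j i)%g).
    by rewrite -mulgA -expgnDr subnK ?(ltnW lt_j) // sb mulgA.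
  - exists (j i - j i'), (a ^- l)%g; split; [lia| |by exists l; right|].
      apply: leq_trans (b1 _) _; move: bb.
      rewrite -{1}(subnKC (ltnW lt_j)) expgnDr invgM.
      by rewrite mulgVK (wlenV genS).
    apply: (@mulgI _ (a ^+ l)%g); apply: (@mulIg _ (b ^+ j i')%g).
    rewrite mulVKg sb -{2}(subnK (ltnW lt_j)) expgnDr !mulgA.
    by [].
  - exfalso; move: sb; rewrite -eq_j => /esym/eqP.
    rewrite -[X in _ == X]mul1g => /eqP/mulIg al.
    by have := a1 l; rewrite al wlen1 //; lia.
(* Since [s b^(qe) = y^q s], division of [j i] by [e] leaves [s] as an element of the cyclic group
   of [a] times [c i * b^-r], which is short because [r < e <= R1]. *)
pose q := j i %/ e; pose r := j i %% e.
have sq x : (s * b ^+ (x * e) = y ^+ x * s)%g.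
  elim: x => [|x IH]; first by rewrite mul0n !expg0 mulg1 mul1g.
  by rewrite mulSn addnC expgnDr mulgA IH -mulgA sbe mulgA -expgSr.
exists (y ^- q * a ^+ (i0 + i))%g, (c i * b ^- r)%g; split.
- refine (cyclic_subgroupM _ _); last by exists (i0 + i); left.
  by refine (cyclic_subgroupV (cyclic_subgroupX _ _)).
- rewrite -mulgA (mulgA (a ^+ _)%g) /c mulVKg.
  rewrite (divn_eq (j i) e) -/q -/r expgnDr !mulgA mulgK -mulgA sq.
  by rewrite mulKg.
- apply: leq_trans (wlenM genS _ _) _; apply: leq_add; first exact: jP.
  rewrite (wlenV genS); apply: leq_trans (len_expg_le _ _) _.
  by rewrite leq_mul2r (leq_trans _ eR) ?orbT // ltnW // ltn_mod.
Qed.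
End FellowTravel.

(** [finite_index] counts left cosets, while the cover is by right cosets [A u]; inversion exchanges
    the two. *)
Lemma finite_index_cover (G : groupType) (A : set G) (B : seq G) :
  (forall a b, A a -> A b -> A (a * b)%g) -> (forall a, A a -> A a^-1%g) ->
  (forall x, exists a u, [/\ A a, u \in B & x = (a * u)%g]) -> finite_index A.
Proof.
move=> AM AV cov.
apply: (@sub_finite_set _ _
  ((fun u : G => [set (u^-1 * h)%g | h in A]) @` [set` B])%classic); last first.
  exact/finite_image/finite_seq.
move=> _ [x _ <-]; have [a [u [Aa uB xE]]] := cov x^-1%g.
exists u => //=; have -> : x = (u^-1 * a^-1)%g by rewrite -invgM -xE invgK.
apply/seteqP; split => _ [h Ah <-].
  by exists (a * h)%g; [exact: AM|rewrite mulgA mulgVK].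
by exists (a^-1 * h)%g; [apply/AM/Ah/AV|rewrite mulgA].
Qed.

(** * Pairs of independent loxodromic elements *)

Section Schottky.
Local Open Scope nat_scope.
Variables (G : groupType) (S : set G).
Hypothesis genS : generates S.
Hypothesis finS : finite_set S.
Local Notation len := (wlen S).
Local Notation dist := (wdist S).
Local Notation gprod := (gprod S).
Variable K : nat.
Hypothesis four_pt : forall a b c d,
  dist a d + dist b c <= dist a c + dist b d + K \/
  dist a d + dist b c <= dist a b + dist d c + K.
Hypothesis nonelem : ~ virtually_cyclic G.
Local Ltac glia := group_canon G; lia.

Lemma len_unbounded n : exists g, n <= len g.
Proof.
apply: contrapT => /forallNP bnd; apply: nonelem; exists 1%g.
have [B BP] := wlen_ball_finite genS n finS.
apply: (@finite_index_cover _ _ B).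
- by move=> a b; refine (@cyclic_subgroupM _ _ _ _).
- by move=> a; refine (@cyclic_subgroupV _ _ _).
move=> x; exists 1%g, x; rewrite mul1g; split => //; first by exists 0; left.
by apply: BP; rewrite leqNgt; apply/negP => /ltnW /bnd.
Qed.

Lemma cyclic_subgroup_sub (g : G) (b : bool) (y : G) :
  cyclic_subgroup (if b then g^-1%g else g) y -> cyclic_subgroup g y.
Proof.
case: b => // -[n [->|->]]; exists n; rewrite expVgn; first by right.
by left; rewrite invgK.
Qed.

Lemma schottky_pair : exists C, forall N, exists u v,
  [/\ N <= len u, N <= len v, gprod u u^-1%g <= C, gprod v v^-1%g <= C &
   [/\ gprod u v <= C, gprod u v^-1%g <= C, gprod u^-1%g v <= C &
    gprod u^-1%g v^-1%g <= C]].
Proof.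
have [g gA] := unbounded_len_loxodromic genS four_pt (3 * K + 1) len_unbounded.
have KA : 3 * K < 3 * K + 1 by rewrite addn1.
have axg : axis S (len g) g.
  split.
  - refine (loxodromic_len_ge genS four_pt KA gA).
  - refine (loxodromic_len_mono genS four_pt KA gA).
  - refine (loxodromic_gprod genS four_pt KA gA).
pose gg (b : bool) := if b then g^-1%g else g.
have axgg b : axis S (len g) (gg b) by case: b => //; apply: axisV.
have {gA} [Rad RadP] : exists Rad, forall (p : bool * bool) s,
    (forall T, exists n m,
       T < gprod (gg p.1 ^+ n)%g (s * gg p.2 ^+ m)%g) ->
    exists y u, [/\ cyclic_subgroup g y, s = (y * u)%g & len u <= Rad].
  have rad p := axes_diverge genS four_pt (axgg p.1) (axgg p.2) finS.
  have [f fP] := choice (rad : forall p : bool * bool, _).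
  exists (\max_p f p) => p s /fP[y [u [/cyclic_subgroup_sub gy -> lu]]].
  by exists y, u; split => //; apply: leq_trans lu (leq_bigmax p).
have [s sP] : exists s, forall y u, cyclic_subgroup g y -> s = (y * u)%g ->
    ~ len u <= Rad.
  apply: contrapT => /forallNP near; apply: nonelem; exists g.
  have [B BP] := wlen_ball_finite genS Rad finS.
  apply: (@finite_index_cover _ _ B).
  - by move=> a b; refine (@cyclic_subgroupM _ _ _ _).
  - by move=> a; refine (@cyclic_subgroupV _ _ _).
  move=> x; apply: contrapT => /forallNP far; apply: (near x) => y u gy xE lu.
  by apply: (far y); exists u; split => //; apply: BP.
have [T TP] : exists T, forall (p : bool * bool) n m,
    gprod (gg p.1 ^+ n)%g (s * gg p.2 ^+ m)%g <= T.
  have bnd (p : bool * bool) : exists T, forall n m,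
      gprod (gg p.1 ^+ n)%g (s * gg p.2 ^+ m)%g <= T.
    apply: contrapT => /forallNP far; have [|y [u [gy sE]]] := RadP p s.
      move=> T0; have := far T0.
      move=> /existsNP[n /existsNP[m /negP]]; rewrite -ltnNge => nm.
      by exists n, m.
    exact: sP gy sE.
  have [f fP] := choice bnd.
  by exists (\max_p f p) => p n m; apply: leq_trans (fP p n m) (leq_bigmax p).
exists (T + len g + 8 * len s) => N.
have [g1 _ g3] := axg.
(* Conjugation by [s] shortens [g ^+ M] by at most [2 * len s], which the larger exponent makes up
   for. *)
pose M := N + 2 * len s; exists (g ^+ N)%g, (s * g ^+ M * s^-1)%g.
have close b c : gprod (gg b ^+ N)%g (s * gg c ^+ M * s^-1)%g <=
    T + len g + 8 * len s.
  have := TP (b, c) N M => /=.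
  have := gprodE genS (gg b ^+ N)%g (s * gg c ^+ M)%g.
  have := gprodE genS (gg b ^+ N)%g (s * gg c ^+ M * s^-1)%g.
  have := wlenM genS (s * gg c ^+ M)%g s^-1%g.
  have := wlenM genS ((gg b ^+ N)^-1 * (s * gg c ^+ M * s^-1))%g s.
  rewrite -(mulgA _ _ s) (mulgVK s) (wlenV genS s); glia.
split.
- exact: g1.
- have := g1 M.
  have := wlenM genS s^-1%g (s * g ^+ M * s^-1 * s)%g.
  have := wlenM genS (s * g ^+ M * s^-1)%g s.
  by rewrite mulgVK mulKg (wlenV genS s) /M; glia.
- by have := g3 N N; lia.
- have := g3 M M.
  have := gprodE genS (g ^+ M)%g (g ^- M)%g.
  have := gprodE genS (s * g ^+ M * s^-1)%g (s * g ^+ M * s^-1)^-1%g.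
  have := wlenM genS s^-1%g (s * (g ^- M * g ^- M) * s^-1 * s)%g.
  have := wlenM genS (s * (g ^- M * g ^- M) * s^-1)%g s.
  have := wlenM genS s (g ^+ M * s^-1)%g.
  have := wlenM genS (g ^+ M)%g s^-1%g.
  have -> : ((s * g ^+ M * s^-1)^-1 * (s * g ^+ M * s^-1)^-1 =
      s * (g ^- M * g ^- M) * s^-1)%g.
    by rewrite !invgM invgK !mulgA mulgVK.
  rewrite mulgVK mulKg (mulgA s) !(wlenV genS); glia.
- split.
  + exact: (close false false).
  + by have := close false true; rewrite /= expVgn !invgM invgK mulgA.
  + by have := close true false; rewrite /= expVgn.
  + by have := close true true; rewrite /= !expVgn !invgM invgK mulgA.
Qed.
End Schottky.

(** * Drift away from a quasiconvex subgroup *)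

Section Drift.
Local Open Scope nat_scope.
Variables (G : groupType) (S : set G).
Hypothesis genS : generates S.
Hypothesis finS : finite_set S.
Variable H : groupClosed G.
Local Notation len := (wlen S).
Local Notation dist := (wdist S).
Local Notation gprod := (gprod S).
Local Ltac glia := group_canon G; lia.

Lemma ex_dist_to (x : G) : exists n, `[< exists2 h, h \in H & dist h x = n >].
Proof.
by exists (dist 1%g x); apply/asboolP; exists 1%g => //; exact: gpred1.
Qed.

Definition dist_to (x : G) : nat := ex_minn (ex_dist_to x).

Lemma dist_toP x : exists2 h, h \in H & dist h x = dist_to x.
Proof. by rewrite /dist_to; case: ex_minnP => n /asboolP. Qed.

Lemma dist_to_le x h : h \in H -> dist_to x <= dist h x.
Proof.
move=> hH; rewrite /dist_to; case: ex_minnP => n _; apply.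
by apply/asboolP; exists h.
Qed.

Lemma dist_toM h x : h \in H -> dist_to (h * x)%g = dist_to x.
Proof.
suff le k y : k \in H -> dist_to (k * y)%g <= dist_to y.
  move=> hH; apply/eqP; rewrite eqn_leq le //= -{1}(mulKg h x) le //.
  by rewrite gpredV.
move=> kH; have [g gH <-] := dist_toP y.
by rewrite -(wdistM S k g) dist_to_le // gpredM.
Qed.

Lemma dist_to_lip x q : dist_to (x * q)%g <= dist_to x + len q.
Proof.
have [h hH <-] := dist_toP x; apply: leq_trans (dist_to_le _ hH) _.
apply: leq_trans (wdist_triangle genS x _ _) _.
by rewrite leq_add2l /wdist mulKg.
Qed.

Lemma dist_to_lipV x q : dist_to x <= dist_to (x * q)%g + len q.
Proof. by have := dist_to_lip (x * q)%g q^-1%g; rewrite mulgK (wlenV genS). Qed.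

Variable K : nat.
Hypothesis four_pt : forall a b c d,
  dist a d + dist b c <= dist a c + dist b d + K \/
  dist a d + dist b c <= dist a b + dist d c + K.
Variable Q : nat.
Hypothesis qcH : forall a b c, b \in H -> c \in H -> exists2 h, h \in H &
  2 * dist a h + dist b c <= dist a b + dist a c + Q.

(* Twice the Gromov product of [x z] and [H] at [x]. *)
Definition gprod_to (x z : G) : nat := len z + dist_to x - dist_to (x * z)%g.

(** Let [p] and [q] be points of [H] nearest to [x z] and [x w]. Hyperbolicity at [x] along [x z],
    [p], [q], [x w] makes one of the three consecutive products at most that of [z] and [w], up to
    [2 * K]. The outer two dominate [gprod_to]; by quasiconvexity the middle one is at least twice
    the distance from [x] to [H], up to [Q]. *)
Lemma gprod_to_hyp x z w :
  [\/ gprod_to x z <= gprod z w + (2 * K + Q),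
      gprod_to x w <= gprod z w + (2 * K + Q) |
      2 * dist_to x <= gprod z w + (2 * K + Q)].
Proof.
have [p pH pz] := dist_toP (x * z)%g; have [q qH qw] := dist_toP (x * w)%g.
have [h hH xh] := qcH x pH qH.
have := dist_to_le x hH; rewrite (wdistC genS h x) => lexh.
have := dist_to_le x pH; rewrite (wdistC genS p x) => lexp.
have := dist_to_le x qH; rewrite (wdistC genS q x) => lexq.
rewrite (wdistC genS) in pz; rewrite (wdistC genS) in qw.
have := four_pt x (x * z)%g (x * w)%g p; have := four_pt x p (x * w)%g q.
have := gprodE genS z w; rewrite -/(wdist S z w) -(wdistM S x).
have -> : dist (x * z)%g p = dist_to (x * z)%g by [].
have xE y : len y = dist x (x * y)%g by rewrite /wdist mulKg.
have ez := xE z; have ew := xE w.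
rewrite (wdistC genS q (x * w)%g) qw /gprod_to => h1 h2 h3.
have : [\/ len z + dist_to x <= gprod z w + (2 * K + Q) + dist_to (x * z)%g,
  len w + dist_to x <= gprod z w + (2 * K + Q) + dist_to (x * w)%g |
  2 * dist_to x <= gprod z w + (2 * K + Q)].
  have [|] := leqP (len z + dist_to x)
    (gprod z w + (2 * K + Q) + dist_to (x * z)%g); first by constructor 1.
  have [|] := leqP (len w + dist_to x)
    (gprod z w + (2 * K + Q) + dist_to (x * w)%g); first by constructor 2.
  have [|] := leqP (2 * dist_to x) (gprod z w + (2 * K + Q)).
    by constructor 3.
  by move: ez ew h1 h2 h3 xh lexh lexp lexq; glia.
by case=> ?; [constructor 1|constructor 2|constructor 3] => //; lia.
Qed.

Lemma gprod_toE x z : gprod_to x z + dist_to (x * z)%g = len z + dist_to x.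
Proof. by rewrite /gprod_to subnK // addnC dist_to_lip. Qed.

Lemma gprod_to_le x z : gprod_to x z <= 2 * len z.
Proof. by have := gprod_toE x z; have := dist_to_lipV x z; lia. Qed.

Hypothesis infH : ~ finite_index [set` H]%classic.
Hypothesis nonelem : ~ virtually_cyclic G.

Lemma dist_to_unbounded n : exists y, n <= dist_to y.
Proof.
apply: contrapT => /forallNP bnd; apply: infH.
have [B BP] := wlen_ball_finite genS n finS.
apply: (@finite_index_cover _ _ B).
- by move=> a b aH bH; exact: gpredM.
- by move=> a aH; rewrite /= gpredV.
move=> x; have [h hH hx] := dist_toP x.
exists h, (h^-1 * x)%g; rewrite mulVKg; split => //.
apply: BP; rewrite -/(wdist S h x) hx leqNgt; apply/negP => /ltnW.
exact: bnd.
Qed.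

Lemma sum_dist_to_ge (s : seq G) x :
  size s * dist_to x <= \sum_(q <- s) dist_to (x * q)%g + \sum_(q <- s) len q.
Proof.
elim: s => [|q s IH]; first by rewrite !big_nil.
by rewrite !big_cons /=; have := dist_to_lipV x q; move: IH; lia.
Qed.

Lemma perm_eq_symmetrize (s : seq G) :
  perm_eq [seq q^-1%g | q <- s ++ [seq q^-1%g | q <- s]]
    (s ++ [seq q^-1%g | q <- s]).
Proof.
have sK : [seq q^-1%g | q <- [seq q^-1%g | q <- s]] = s.
  by rewrite -map_comp -[RHS]map_id; apply: eq_map => q /=; rewrite invgK.
by rewrite map_cat sK perm_catC.
Qed.

(* Two independent loxodromic elements with long powers make the distance to
   [H] drift away when [x] is far from [H]: at most one of the four directions
   leads to [H].  Near [H], some element of the form [c^-1 y] moves [x] far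
   away from [H]. *)
Lemma positive_drift : exists s : seq G,
  perm_eq [seq q^-1%g | q <- s] s /\
  forall x, size s * dist_to x < \sum_(q <- s) dist_to (x * q)%g.
Proof.
have [C CP] := schottky_pair genS finS four_pt nonelem.
pose C1 := C + (2 * K + Q).
have [B BP] := wlen_ball_finite genS C1 finS.
(* [m] is the size of the final symmetric list. The element [y] is chosen so far from [H] that a
   single term equal to [dist_to y] outweighs [m] terms of size at most [C1]. *)
pose m := 4 + 2 * size B.
have [y yP] := dist_to_unbounded (m * C1 + 1).
pose O : seq G := [seq (c^-1 * y)%g | c <- B].
(* The gain along [u], [v] and their inverses must exceed both the error [3 * C1] and the possible
   loss along [O] and its inverses. *)
pose N := 3 * C1 + 2 * \sum_(q <- O) len q + 1.
have [u [v [uN vN uu vv [uv uv' u'v u'v']]]] := CP N.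
pose s := u :: v :: O.
exists (s ++ [seq q^-1%g | q <- s]); split; first exact: perm_eq_symmetrize.
move=> x; have szO : size (s ++ [seq q^-1%g | q <- s]) = m.
  by rewrite size_cat /= !size_map /m; move: (size B) => b; lia.
have [near|far] := leqP (dist_to x) C1.
  have [h hH hx] := dist_toP x; pose c := (h^-1 * x)%g.
  have cB : c \in B by apply: BP; rewrite /c -/(wdist S h x) hx.
  rewrite szO; apply: (@leq_trans (dist_to y)).
    have : m * dist_to x <= m * C1 by rewrite leq_mul2l near orbT.
    by move: yP; lia.
  have qO : (c^-1 * y)%g \in O by apply: map_f.
  have yE : dist_to y = dist_to (x * (c^-1 * y))%g.
    by rewrite /c invgM invgK -mulgA mulVKg dist_toM.
  rewrite yE big_cat /= !big_cons (big_rem _ qO) /=; lia.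
(* At most one of the four values of [gprod_to] exceeds [C1]. It costs at most twice the length of
   its own element, so the gain from the two directions of the other element remains. *)
have four : 4 * dist_to x + 2 * N <= 3 * C1 +
    (dist_to (x * u)%g + dist_to (x * v)%g +
     dist_to (x * u^-1)%g + dist_to (x * v^-1)%g).
  have pair z w : gprod z w <= C -> gprod_to x z <= C1 \/ gprod_to x w <= C1.
    by move=> zw; have [] := gprod_to_hyp x z w; move: far; rewrite /C1; lia.
  have := pair _ _ uu; have := pair _ _ vv; have := pair _ _ uv.
  have := pair _ _ uv'; have := pair _ _ u'v; have := pair _ _ u'v'.
  have := gprod_to_le x u; have := gprod_to_le x u^-1%g.
  have := gprod_to_le x v; have := gprod_to_le x v^-1%g.
  have := gprod_toE x u; have := gprod_toE x u^-1%g.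
  have := gprod_toE x v; have := gprod_toE x v^-1%g.
  rewrite !(wlenV genS); move: uN vN; clearbody N C1.
  move: (gprod_to x u) (gprod_to x v) (gprod_to x u^-1%g) (gprod_to x v^-1%g).
  move: (dist_to (x * u)%g) (dist_to (x * v)%g) (dist_to (x * u^-1)%g).
  move: (dist_to (x * v^-1)%g) (dist_to x) (len u) (len v).
  by clear - C1 N; lia.
have sO := sum_dist_to_ge O x.
have sO' := sum_dist_to_ge [seq q^-1%g | q <- O] x.
have lenO : \sum_(q <- [seq q^-1%g | q <- O]) len q = \sum_(q <- O) len q.
  by rewrite big_map; apply: eq_bigr => q _; rewrite (wlenV genS).
rewrite lenO in sO'.
rewrite szO big_cat /= !big_cons /m.
rewrite !size_map in sO sO'.
move: four sO sO'; rewrite /N mulnDl -mulnA.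
move: (\sum_(q <- O) len q) => X1.
move: (\sum_(q <- O) dist_to (x * q)%g) => X2.
move: (\sum_(q <- [seq q^-1%g | q <- O]) dist_to (x * q)%g) => X3.
move: (size B * dist_to x) => b; lia.
Qed.
End Drift.

(** * Spectral gap on the coset space *)

Section FinitelySupportedSums.
Variables (R : realType) (X : choiceType).
Implicit Types v w : X -> R.

Definition fsupp v : Prop := exists s : seq X, forall x, x \notin s -> v x = 0.

(** By convention the sum is 0 when the support is infinite, so additivity and monotonicity require
    [fsupp]. *)
Definition tot v : R := \sum_(x \in [set: X]%classic) v x.

Lemma totE v (s : seq X) : uniq s -> (forall x, x \notin s -> v x = 0) ->
  tot v = \sum_(x <- s) v x.
Proof.
move=> us sv; rewrite /tot (fsbigE s) //=; last by move=> x _; exact: sv.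
by apply: eq_bigl => x; rewrite in_setT.
Qed.

Lemma fsupp2 v w : fsupp v -> fsupp w -> exists s : seq X,
  [/\ uniq s, forall x, x \notin s -> v x = 0 &
   forall x, x \notin s -> w x = 0].
Proof.
move=> [s sv] [r rw]; exists (undup (s ++ r)).
rewrite undup_uniq; split => // x.
  by rewrite mem_undup mem_cat negb_or => /andP[/sv].
by rewrite mem_undup mem_cat negb_or => /andP[_ /rw].
Qed.

Lemma fsupp_le v w : fsupp v -> (forall x, v x = 0 -> w x = 0) -> fsupp w.
Proof. by move=> [s sv] vw; exists s => x /sv/vw. Qed.

Lemma fsupp_le2 v w u : fsupp v -> fsupp w ->
  (forall x, v x = 0 -> w x = 0 -> u x = 0) -> fsupp u.
Proof.
move=> fv fw vwu; have [s [_ sv sw]] := fsupp2 fv fw.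
by exists s => x xs; rewrite vwu ?sv ?sw.
Qed.

Lemma fsuppD v w : fsupp v -> fsupp w -> fsupp (fun x => v x + w x).
Proof. by move=> fv fw; apply: fsupp_le2 fv fw _ => x -> ->; rewrite addr0. Qed.

Lemma fsuppB v w : fsupp v -> fsupp w -> fsupp (fun x => v x - w x).
Proof. by move=> fv fw; apply: fsupp_le2 fv fw _ => x -> ->; rewrite subr0. Qed.

Lemma fsuppX v n : fsupp v -> fsupp (fun x => v x ^+ n.+1).
Proof. by move=> fv; apply: fsupp_le fv _ => x ->; rewrite expr0n. Qed.

Lemma fsuppMl v w : fsupp v -> fsupp (fun x => v x * w x).
Proof. by move=> fv; apply: fsupp_le fv _ => x ->; rewrite mul0r. Qed.

Lemma fsuppMr v w : fsupp v -> fsupp (fun x => w x * v x).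
Proof. by move=> fv; apply: fsupp_le fv _ => x ->; rewrite mulr0. Qed.

Lemma fsuppZ (c : R) v : fsupp v -> fsupp (fun x => c * v x).
Proof. exact: fsuppMr. Qed.

Lemma fsupp_sum (I : Type) (r : seq I) (P : pred I) (F : I -> X -> R) :
  (forall i, fsupp (F i)) -> fsupp (fun x => \sum_(i <- r | P i) F i x).
Proof.
move=> fF; elim: r => [|i r IH]; first by exists [::] => x; rewrite big_nil.
apply: fsupp_le2 (fF i) IH _ => x Fi Fr.
by rewrite big_cons Fi Fr addr0 if_same.
Qed.

Lemma totD v w : fsupp v -> fsupp w ->
  tot (fun x => v x + w x) = tot v + tot w.
Proof.
move=> fv fw; have [s [us sv sw]] := fsupp2 fv fw.
rewrite !(totE us) ?big_split // => x xs.
by rewrite sv ?sw ?addr0.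
Qed.

Lemma totZ (c : R) v : tot (fun x => c * v x) = c * tot v.
Proof. by rewrite /tot mulr_fsumr. Qed.

Lemma eq_tot v w : v =1 w -> tot v = tot w.
Proof. by move=> vw; congr tot; exact: funext. Qed.

Lemma tot0 : tot (fun=> 0) = 0.
Proof. by rewrite (@totE _ [::]) // big_nil. Qed.

Lemma tot_sum (I : Type) (r : seq I) (P : pred I) (F : I -> X -> R) :
  (forall i, fsupp (F i)) ->
  tot (fun x => \sum_(i <- r | P i) F i x) = \sum_(i <- r | P i) tot (F i).
Proof.
move=> fF; elim: r => [|i r IH].
  rewrite big_nil -[RHS]tot0; apply: eq_tot => x; exact: big_nil.
rewrite big_cons -IH; under eq_tot do rewrite big_cons.
by case: (P i) => //; rewrite totD //; exact: fsupp_sum.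
Qed.

Lemma tot_ge0 v : (forall x, 0 <= v x) -> 0 <= tot v.
Proof. by move=> v0; apply: fsumr_ge0. Qed.

Lemma tot_le v w : fsupp v -> fsupp w -> (forall x, v x <= w x) ->
  tot v <= tot w.
Proof.
move=> fv fw vw; have [s [us sv sw]] := fsupp2 fv fw.
by rewrite !(totE us) //; apply: ler_sum.
Qed.

Lemma tot_ge_term v x : fsupp v -> (forall y, 0 <= v y) -> v x <= tot v.
Proof.
move=> [s sv] v0; rewrite (totE (undup_uniq s)); last first.
  by move=> y; rewrite mem_undup; exact: sv.
have [xs|/sv->] := boolP (x \in s); last exact: sumr_ge0.
rewrite (big_rem x) ?mem_undup //= lerDl; exact: sumr_ge0.
Qed.
End FinitelySupportedSums.

Section SpectralGap.
Variables (R : realType) (X : choiceType) (G : groupType).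
Variable act : X -> G -> X.
Hypothesis act1 : forall x, act x 1%g = x.
Hypothesis actM : forall x g h, act (act x g) h = act x (g * h)%g.
Implicit Types v w : X -> R.

Lemma tot_shift g v : tot (fun x => v (act x g)) = tot v.
Proof.
rewrite /tot; apply/esym/reindex_fsbigT.
exists (fun x => act x g^-1%g) => x; rewrite actM ?mulgV ?mulVg act1 //.
Qed.

Lemma fsupp_shift g v : fsupp v -> fsupp (fun x => v (act x g)).
Proof.
move=> [s sv]; exists [seq act x g^-1%g | x <- s] => x xs; apply: sv.
apply: contra xs => xgs; apply/mapP; exists (act x g) => //.
by rewrite actM mulgV act1.
Qed.

(** The two sides differ by [(a s - b)^2 / s]. With [s] the ratio of the values of [f] at two
    neighbours, this is Barta's inequality edge by edge. *)
Lemma amgm2 (a b s : R) : 0 < s ->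
  a ^+ 2 * (1 - s) + b ^+ 2 * (1 - s^-1) <= (a - b) ^+ 2.
Proof.
move=> s0; rewrite -subr_ge0.
have -> : (a - b) ^+ 2 - (a ^+ 2 * (1 - s) + b ^+ 2 * (1 - s^-1)) =
    (a * s - b) ^+ 2 / s by field; rewrite gt_eqF.
by rewrite divr_ge0 ?sqr_ge0 // ltW.
Qed.

Variables (Q : seq G) (f : X -> R) (rho : R).
Hypothesis symQ : perm_eq [seq q^-1%g | q <- Q] Q.
Hypothesis f0 : forall x, 0 < f x.
Hypothesis superharmonic : forall x, \sum_(q <- Q) f (act x q) <= rho * f x.

(* Barta's argument: a positive function decreased by the averaging operator
   bounds its spectrum. *)
Lemma superharmonic_gap v : fsupp v ->
  2 * ((size Q)%:R - rho) * tot (fun x => v x ^+ 2) <=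
  \sum_(q <- Q) tot (fun x => (v x - v (act x q)) ^+ 2).
Proof.
move=> fv; have fv2 := fsuppX 1 fv.
pose A q := tot (fun x => v x ^+ 2 * (1 - f (act x q) / f x)).
have fA q : fsupp (fun x => v x ^+ 2 * (1 - f (act x q) / f x)).
  exact: fsuppMl.
(* Shifting [A q^-1] by [q] inverts the ratio of values of [f], which gives the two terms of
   [amgm2]; by symmetry of [Q] both contribute the same total. *)
have step q : A q + A q^-1%g <= tot (fun x => (v x - v (act x q)) ^+ 2).
  rewrite /A -(tot_shift q (fun x => v x ^+ 2 * (1 - f (act x q^-1%g) / f x))).
  rewrite -(totD (fA q) (fsupp_shift q (fA q^-1%g))).
  apply: tot_le (fsuppD (fA q) (fsupp_shift q (fA q^-1%g))) _ _.
    exact/(fsuppX 1)/(fsuppB fv)/(fsupp_shift q fv).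
  move=> x; rewrite actM mulgV act1.
  have := amgm2 (v x) (v (act x q)) (divr_gt0 (f0 (act x q)) (f0 x)).
  by rewrite invf_div.
apply: le_trans (ler_sum _ (fun q _ => step q)).
rewrite big_split /=; have -> : \sum_(q <- Q) A q^-1%g = \sum_(q <- Q) A q.
  by rewrite -(perm_big _ symQ) big_map; apply: eq_bigr => q _; rewrite ?invgK.
rewrite -mulr2n -[leRHS]mulr_natl -mulrA ler_pM2l ?ltr0n //.
rewrite /A -tot_sum; last first.
  by move=> q; apply: fsuppMl.
rewrite -totZ; apply: tot_le.
- exact: fsuppMr.
- by apply: fsupp_sum => q; apply: fsuppMl.
move=> x; rewrite -mulr_sumr mulrC ler_wpM2l ?sqr_ge0 //.
rewrite big_split /= sumrN big_const_seq count_predT iter_addr addr0 lerD2l.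
by rewrite lerN2 -mulr_suml ler_pdivrMr.
Qed.
End SpectralGap.

(** * From positive drift to a superharmonic function *)

Section DriftSuperharmonic.
Variables (R : realType) (X : Type) (G : eqType) (act : X -> G -> X).

Lemma expr_1B_le (h : R) n : 0 <= h <= 1 ->
  (1 - h) ^+ n <= 1 - n%:R * h + n%:R ^+ 2 * h ^+ 2.
Proof.
move=> /andP[h0 h1]; elim: n => [|n IH].
  by rewrite expr0 mul0r expr0n mul0r subr0 addr0.
have h1' : 0 <= 1 - h by rewrite subr_ge0.
rewrite exprS; apply: le_trans (ler_wpM2l h1' IH) _.
have n0 : 0 <= n%:R :> R by [].
rewrite -natr1 -subr_ge0.
have -> : 1 - (n%:R + 1) * h + (n%:R + 1) ^+ 2 * h ^+ 2 -
    (1 - h) * (1 - n%:R * h + n%:R ^+ 2 * h ^+ 2) =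
    h ^+ 2 * (n%:R + 1 + n%:R ^+ 2 * h) by ring.
by rewrite mulr_ge0 ?sqr_ge0 // !addr_ge0 // mulr_ge0 ?sqr_ge0.
Qed.

Lemma expr_1B_ge (h : R) n : 0 <= h <= 1 -> 1 - n%:R * h <= (1 - h) ^+ n.
Proof.
move=> /andP[h0 h1]; elim: n => [|n IH]; first by rewrite expr0 mul0r subr0.
have h1' : 0 <= 1 - h by rewrite subr_ge0.
rewrite exprS; apply: le_trans (ler_wpM2l h1' IH).
rewrite -natr1 -subr_ge0.
have -> : (1 - h) * (1 - n%:R * h) - (1 - (n%:R + 1) * h) = n%:R * h ^+ 2.
  by ring.
by rewrite mulr_ge0 ?sqr_ge0.
Qed.

(** A second-order expansion of a power of [1 - h] with exponent [e - d] of either sign. For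
    [e < d], Bernoulli bounds the inverse power below, and [D h <= 1/2] lets the quadratic term
    compensate for the inversion. *)
Lemma expr_1B_drift (h : R) (D d e : nat) :
  0 <= h -> D%:R * h <= 1 / 2 -> h <= 1 / 2 ->
  (e <= d + D)%N -> (d <= e + D)%N ->
  (1 - h) ^+ e <= (1 - h) ^+ d *
    (1 - h * (e%:R - d%:R) + 2 * D%:R ^+ 2 * h ^+ 2).
Proof.
move=> h0 Dh h2 ed de; have h01 : 0 <= h <= 1 by lra.
have h1 : 0 <= 1 - h by lra.
have [le_de|/ltnW le_ed] := leqP d e.
  have -> : (1 - h) ^+ e = (1 - h) ^+ d * (1 - h) ^+ (e - d).
    by rewrite -exprD subnKC.
  apply: ler_wpM2l; first exact: exprn_ge0.
  apply: le_trans (expr_1B_le _ h01) _; rewrite natrB //.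
  have nD : e%:R - d%:R <= D%:R :> R.
    by rewrite -natrB // ler_nat leq_subLR.
  have n0 : 0 <= e%:R - d%:R :> R by rewrite subr_ge0 ler_nat.
  have : (e%:R - d%:R) ^+ 2 <= D%:R ^+ 2 :> R by rewrite ler_sqr ?nnegrE.
  move=> /(ler_wpM2r (sqr_ge0 h)).
  have := sqr_ge0 (D%:R * h); rewrite exprMn; lra.
have -> : (1 - h) ^+ d = (1 - h) ^+ e * (1 - h) ^+ (d - e).
  by rewrite -exprD subnKC.
rewrite -mulrA -{1}(mulr1 ((1 - h) ^+ e)).
apply: ler_wpM2l; first exact: exprn_ge0.
set n : R := d%:R - e%:R; have nE : (d - e)%:R = n by rewrite natrB.
have n0 : 0 <= n by rewrite subr_ge0 ler_nat.
have nD : n <= D%:R by rewrite -nE ler_nat leq_subLR.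
have := expr_1B_ge (d - e) h01; rewrite nE => bern.
have -> : e%:R - d%:R = - n by rewrite /n opprB.
have nh : n * h <= D%:R * h by exact: ler_wpM2r.
have nh0 : 0 <= n * h by exact: mulr_ge0.
set D2 := D%:R * h in Dh nh.
have -> : 2 * D%:R ^+ 2 * h ^+ 2 = 2 * D2 ^+ 2 by rewrite /D2; ring.
set t := n * h in bern nh nh0.
have -> : 1 - h * - n = 1 + t by rewrite /t; ring.
have s0 : 0 <= 1 + t + 2 * D2 ^+ 2.
  by have := sqr_ge0 D2; lra.
apply: le_trans (ler_wpM2r s0 bern).
have : t ^+ 2 <= D2 ^+ 2 by rewrite ler_sqr ?nnegrE //; lra.
have : t * D2 ^+ 2 <= 1 / 2 * D2 ^+ 2.
  by apply: ler_wpM2r; rewrite ?sqr_ge0 //; lra.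
rewrite -subr_ge0 => P1; rewrite -subr_ge0 => P2; rewrite -subr_ge0.
have -> : (1 - t) * (1 + t + 2 * D2 ^+ 2) - 1 =
  (D2 ^+ 2 - t ^+ 2) + 2 * (1 / 2 * D2 ^+ 2 - t * D2 ^+ 2) by field.
by lra.
Qed.

(** By integrality the drift is at least 1 everywhere. With [l = 1 - h], the first-order term gains
    at least [h], while the choice of [h] keeps the total second-order error below [h / 2]. *)
Lemma drift_superharmonic (Q : seq G) (d : X -> nat) (D : nat) :
  (forall x q, q \in Q ->
    (d (act x q) <= d x + D)%N /\ (d x <= d (act x q) + D)%N) ->
  (forall x, (size Q * d x < \sum_(q <- Q) d (act x q))%N) ->
  exists l rho : R, [/\ 0 < l, rho < (size Q)%:R &
    forall x, \sum_(q <- Q) l ^+ d (act x q) <= rho * l ^+ d x].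
Proof.
move=> lip drift; set N := size Q in drift *.
pose h : R := (4 * N%:R * D%:R ^+ 2 + 2 * D%:R + 2)^-1.
have N0 : 0 <= N%:R :> R by [].
have D0 : 0 <= D%:R :> R by [].
have ND : 0 <= N%:R * D%:R ^+ 2 :> R by rewrite mulr_ge0 // sqr_ge0.
have p0 : 0 < 4 * N%:R * D%:R ^+ 2 + 2 * D%:R + 2 :> R by lra.
have h0 : 0 < h by rewrite invr_gt0.
have hE : h * (4 * N%:R * D%:R ^+ 2 + 2 * D%:R + 2) = 1.
  by rewrite mulVf // gt_eqF.
have NDh : 0 <= N%:R * D%:R ^+ 2 * h by rewrite mulr_ge0 // ltW.
have Dh : 0 <= D%:R * h by rewrite mulr_ge0 // ltW.
have Dh2 : D%:R * h <= 1 / 2 by lra.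
have h2 : h <= 1 / 2 by lra.
exists (1 - h), (N%:R - h / 2); split; [lra|lra|move=> x].
have l0 : 0 <= (1 - h) ^+ d x by rewrite exprn_ge0 //; lra.
have step q : q \in Q -> (1 - h) ^+ d (act x q) <= (1 - h) ^+ d x *
    (1 - h * ((d (act x q))%:R - (d x)%:R) + 2 * D%:R ^+ 2 * h ^+ 2).
  by move=> /(lip x)[? ?]; apply: expr_1B_drift => //; exact: ltW.
apply: (@le_trans _ _ (\sum_(q <- Q) (1 - h) ^+ d x *
    (1 - h * ((d (act x q))%:R - (d x)%:R) + 2 * D%:R ^+ 2 * h ^+ 2))).
  by rewrite big_seq [leRHS]big_seq; apply: ler_sum.
rewrite -mulr_sumr [leRHS]mulrC ler_wpM2l // big_split /= big_split /=.
rewrite sumrN -mulr_sumr big_split /= sumrN !big_const_seq count_predT -/N.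
rewrite !iter_addr !addr0 -natr_sum.
have : (N * d x)%:R + 1 <= (\sum_(q <- Q) d (act x q))%:R :> R.
  by rewrite natr1 ler_nat.
set s := (\sum_(q <- Q) _)%N; rewrite natrM -(mulr_natl (d x)%:R).
rewrite -(mulr_natl (_ * _ ^+ 2)) => ds.
have : h * 1 <= h * (s%:R - N%:R * (d x)%:R) by rewrite ler_pM2l //; lra.
have : N%:R * D%:R ^+ 2 * h * h <= 1 / 4 * h.
  by apply: ler_wpM2r; [exact: ltW|lra].
have -> : N%:R * (2 * D%:R ^+ 2 * h ^+ 2) = 2 * (N%:R * D%:R ^+ 2 * h * h).
  by ring.
lra.
Qed.
End DriftSuperharmonic.

(** * Comparison of Dirichlet forms *)

Section Energy.
Variables (R : realType) (X : choiceType) (G : groupType).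
Variable act : X -> G -> X.
Hypothesis act1 : forall x, act x 1%g = x.
Hypothesis actM : forall x g h, act (act x g) h = act x (g * h)%g.
Implicit Types v w : X -> R.

Definition energy (g : G) v : R := tot (fun x => (v x - v (act x g)) ^+ 2).

Lemma sqrD_le (a b : R) : (a + b) ^+ 2 <= 2 * a ^+ 2 + 2 * b ^+ 2.
Proof. by have := sqr_ge0 (a - b); rewrite sqrrB sqrrD; lra. Qed.

Lemma energy_ge0 g v : 0 <= energy g v.
Proof. by apply: tot_ge0 => x; exact: sqr_ge0. Qed.

Lemma fsupp_energy g v : fsupp v -> fsupp (fun x => (v x - v (act x g)) ^+ 2).
Proof. by move=> fv; apply/(fsuppX 1)/fsuppB/(fsupp_shift act1 actM). Qed.

Lemma energy1 v : energy 1%g v = 0.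
Proof.
by rewrite -(tot0 R X); apply: eq_tot => x; rewrite act1 subrr expr0n.
Qed.

Lemma energyM g h v : fsupp v ->
  energy (g * h)%g v <= 2 * energy g v + 2 * energy h v.
Proof.
move=> fv; have fg := fsupp_energy g fv; have fh := fsupp_energy h fv.
rewrite /energy -(tot_shift act1 actM g (fun x => (v x - v (act x h)) ^+ 2)).
have fgh := fsupp_shift act1 actM g fh.
rewrite -!totZ -totD; [|exact: fsuppMr|exact: fsuppMr].
apply: tot_le; [exact: fsupp_energy|by apply: fsuppD; apply: fsuppMr|].
move=> x; rewrite actM; apply: le_trans (sqrD_le _ _).
by rewrite addrA subrK.
Qed.

Variables (L : finType) (la : L -> G).
Hypothesis generated :
  forall g : G, exists w : seq L, g = (\prod_(a <- w) la a)%g.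

(** Induction on a word for [g] through [energyM]; the constant grows exponentially with the word,
    but only its finiteness matters. *)
Lemma energy_le_gen g : exists2 C : R, 0 <= C &
  forall v, fsupp v -> energy g v <= C * \sum_a energy (la a) v.
Proof.
have [w ->] := generated g; elim: w => [|a w [C C0 IH]].
  by exists 0 => // v _; rewrite big_nil energy1 mul0r.
exists (2 + 2 * C) => [|v fv]; first by rewrite addr_ge0 // mulr_ge0.
rewrite big_cons; apply: le_trans (energyM _ _ fv) _.
have := IH v fv.
have : energy (la a) v <= \sum_a energy (la a) v.
  by rewrite (bigD1 a) //= lerDl sumr_ge0 // => b _; exact: energy_ge0.
lra.
Qed.

Lemma energy_gap_gen (Q : seq G) (c : R) : 0 < c ->
  (forall v, fsupp v ->
    c * tot (fun x => v x ^+ 2) <= \sum_(q <- Q) energy q v) ->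
  exists2 c' : R, 0 < c' & forall v, fsupp v ->
    c' * tot (fun x => v x ^+ 2) <= \sum_a energy (la a) v.
Proof.
move=> c0 gap.
have [C C0 CP] : exists2 C : R, 0 <= C & forall v, fsupp v ->
    \sum_(q <- Q) energy q v <= C * \sum_a energy (la a) v.
  elim: Q {gap} => [|q Q [C C0 IH]].
    by exists 0 => // v _; rewrite big_nil mul0r.
  have [D D0 DP] := energy_le_gen q.
  exists (D + C) => [|v fv]; first exact: addr_ge0.
  by rewrite big_cons mulrDl lerD ?DP ?IH.
have C1 : 0 < C + 1 by lra.
exists (c / (C + 1)) => [|v fv]; first exact: divr_gt0.
rewrite mulrAC ler_pdivrMr //.
apply: le_trans (gap v fv) _; apply: le_trans (CP v fv) _.
rewrite mulrC ler_wpM2l //; last by lra.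
by apply: sumr_ge0 => a _; exact: energy_ge0.
Qed.

Variable inv_l : L -> L.
Hypothesis la_inv : forall a, la (inv_l a) = (la a)^-1%g.

(** After a shift this is the energy of [(la a)^-1 * la b]; the present form compares two neighbours
    of one point. *)
Definition disp v a b : R :=
  tot (fun x => (v (act x (la a)) - v (act x (la b))) ^+ 2).

Lemma fsupp_disp v a b : fsupp v ->
  fsupp (fun x => (v (act x (la a)) - v (act x (la b))) ^+ 2).
Proof.
by move=> fv; apply/(fsuppX 1)/fsuppB; apply: (fsupp_shift act1 actM).
Qed.

Lemma disp_ge0 v a b : 0 <= disp v a b.
Proof. by apply: tot_ge0 => x; exact: sqr_ge0. Qed.

Lemma disp_le_sum v a b : disp v a b <= \sum_c \sum_d disp v c d.
Proof.
rewrite (bigD1 a) //= (bigD1 b) //= -addrA lerDl addr_ge0 //.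
  by apply: sumr_ge0 => c _; exact: disp_ge0.
by apply: sumr_ge0 => c _; apply: sumr_ge0 => d _; exact: disp_ge0.
Qed.

(* A nonnegative function that is nearly invariant under the products of two
   letters yields, by adding its shift by one letter, a function that is nearly
   invariant under each letter; this takes care of a possible bipartition. *)
Lemma energy_gap_pairs (a0 : L) (c : R) : 0 < c ->
  (forall v, fsupp v ->
    c * tot (fun x => v x ^+ 2) <= \sum_a energy (la a) v) ->
  exists2 c' : R, 0 < c' & forall v, (forall x, 0 <= v x) -> fsupp v ->
    c' * tot (fun x => v x ^+ 2) <= \sum_a \sum_b disp v a b.
Proof.
move=> c0 gap; have nL : (0 < #|L|)%N by apply/card_gt0P; exists a0.
have nL0 : 0 < #|L|%:R :> R by rewrite ltr0n.
exists (c / (4 * #|L|%:R)) => [|v v0 fv]; first by rewrite divr_gt0 // mulr_gt0.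
pose w x := v x + v (act x (la a0)).
have fw : fsupp w by apply: fsuppD => //; apply: (fsupp_shift act1 actM).
(* Nonnegativity prevents cancellation between [v] and its shift. *)
have vw : tot (fun x => v x ^+ 2) <= tot (fun x => w x ^+ 2).
  apply: tot_le => [||x]; [exact: (fsuppX 1)|exact: (fsuppX 1)|].
  by rewrite ler_sqr ?nnegrE ?addr_ge0 // lerDl.
(* Regroup [w x - w (xa)] as [v (x a0) - v (xa)] plus [v x - v (x a a0)]; the second difference,
   seen from [y = xa], compares [y a^-1] with [y a0]. *)
have wE a : energy (la a) w <= 4 * \sum_a \sum_b disp v a b.
  have e1 := disp_le_sum v a0 a; have e2 := disp_le_sum v (inv_l a) a0.
  suff : energy (la a) w <= 2 * disp v a0 a + 2 * disp v (inv_l a) a0 by lra.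
  have f1 := fsupp_disp a0 a fv; have f2 := fsupp_disp (inv_l a) a0 fv.
  rewrite {2}/disp -(tot_shift act1 actM (la a)).
  have f3 := fsupp_shift act1 actM (la a) f2.
  rewrite -!totZ -totD; [|exact: fsuppMr|exact: fsuppMr].
  apply: tot_le; [exact: fsupp_energy|by apply: fsuppD; apply: fsuppMr|].
  move=> x; apply: le_trans (sqrD_le _ _).
  rewrite /w !actM la_inv mulgV act1 le_eqVlt; apply/orP; left; apply/eqP.
  by congr (_ ^+ 2); ring.
rewrite mulrAC ler_pdivrMr ?mulr_gt0 //.
apply: le_trans (ler_wpM2l (ltW c0) vw) _; apply: le_trans (gap w fw) _.
apply: le_trans (ler_sum _ (fun a _ => wE a)) _.
rewrite sumr_const le_eqVlt; apply/orP; left; apply/eqP.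
move: (\sum_a \sum_b disp v a b) => s; ring.
Qed.
End Energy.

(** * Words read by a regular automaton *)

Section Automaton.
Variables (R : realType) (X : choiceType) (G : groupType).
Variable act : X -> G -> X.
Hypothesis act1 : forall x, act x 1%g = x.
Hypothesis actM : forall x g h, act (act x g) h = act x (g * h)%g.
Variables (L : finType) (la : L -> G) (e : rel L) (d : nat).
Hypothesis row_deg : forall a, #|[pred b | e a b]| = d.
Hypothesis col_deg : forall b, #|[pred a | e a b]| = d.
Hypothesis common_pred : forall b b', exists2 a, e a b & e a b'.
Implicit Types (t : L -> X -> R).

(* In a state [(a, x)], [a] is the next letter to be read and [x] the current
   coset; [e a b] tells that [b] may follow [a]. *)
Definition astep t : L -> X -> R :=
  fun a x => \sum_(b | e a b) t b (act x (la a)).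

Definition nrm t : R := \sum_a tot (fun x => t a x ^+ 2).

Definition spread t : R :=
  \sum_b \sum_b' tot (fun x => (t b x - t b' x) ^+ 2).

(** Cauchy-Schwarz with its exact defect; this defect is what [spread] controls. *)
Lemma sum_sqr_variance (P : pred L) (y : L -> R) :
  (\sum_(b | P b) y b) ^+ 2 +
    2^-1 * \sum_(b | P b) \sum_(b' | P b') (y b - y b') ^+ 2 =
  #|P|%:R * \sum_(b | P b) y b ^+ 2.
Proof.
have -> : \sum_(b | P b) \sum_(b' | P b') (y b - y b') ^+ 2 =
    2 * (#|P|%:R * \sum_(b | P b) y b ^+ 2 - (\sum_(b | P b) y b) ^+ 2).
  pose s := \sum_(b | P b) y b.
  have inner b : \sum_(b' | P b') (y b - y b') ^+ 2 =
      #|P|%:R * y b ^+ 2 + (- 2 * s) * y b + \sum_(b' | P b') y b' ^+ 2.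
    transitivity (\sum_(b' | P b') (y b ^+ 2 + (- 2 * y b) * y b' + y b' ^+ 2)).
      by apply: eq_bigr => b' _; ring.
    by rewrite !big_split /= sumr_const -mulr_sumr mulr_natl mulrAC.
  under eq_bigr do rewrite inner.
  by rewrite !big_split /= sumr_const -!mulr_sumr -/s; ring.
by field.
Qed.

Lemma sqr_sum_le (P : pred L) (y : L -> R) :
  (\sum_(b | P b) y b) ^+ 2 <= #|P|%:R * \sum_(b | P b) y b ^+ 2.
Proof.
rewrite -sum_sqr_variance lerDl mulr_ge0 // sumr_ge0 // => b _.
by apply: sumr_ge0 => b' _; exact: sqr_ge0.
Qed.

Lemma nrm_ge0 t : 0 <= nrm t.
Proof. by apply: sumr_ge0 => a _; apply: tot_ge0 => x; exact: sqr_ge0. Qed.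

Lemma spread_ge0 t : 0 <= spread t.
Proof.
apply: sumr_ge0 => a _; apply: sumr_ge0 => b _.
by apply: tot_ge0 => x; exact: sqr_ge0.
Qed.

Lemma fsupp_astep t : (forall a, fsupp (t a)) -> forall a, fsupp (astep t a).
Proof.
move=> ft a; apply: (@fsupp_sum R X L _ _ (fun b x => t b (act x (la a)))).
by move=> b; apply: (fsupp_shift act1 actM).
Qed.

Lemma fsupp_diff2 t b b' : (forall a, fsupp (t a)) ->
  fsupp (fun x => (t b x - t b' x) ^+ 2).
Proof. by move=> ft; apply/(fsuppX 1)/fsuppB. Qed.

(** Cauchy-Schwarz over the [d] successors gives one factor [d], and each letter having [d]
    predecessors gives the other. As any two letters have a common predecessor, the defects cover
    every pair counted in [spread]. *)
Lemma nrm_astep_le t : (forall a, fsupp (t a)) ->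
  nrm (astep t) + 2^-1 * spread t <= d%:R ^+ 2 * nrm t.
Proof.
move=> ft; pose V a := \sum_(b | e a b) \sum_(b' | e a b')
  tot (fun x => (t b x - t b' x) ^+ 2).
have one a : tot (fun x => astep t a x ^+ 2) + 2^-1 * V a =
    d%:R * \sum_(b | e a b) tot (fun x => t b x ^+ 2).
  rewrite (tot_shift act1 actM (la a) (fun y => (\sum_(b | e a b) t b y) ^+ 2)).
  have f1 b : fsupp (fun x => t b x ^+ 2) by exact: (fsuppX 1).
  have f2 b b' := fsupp_diff2 b b' ft.
  have f3 b : fsupp (fun x => \sum_(b' | e a b') (t b x - t b' x) ^+ 2).
    exact: fsupp_sum.
  have -> : V a = tot (fun x => \sum_(b | e a b) \sum_(b' | e a b')
      (t b x - t b' x) ^+ 2).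
    rewrite tot_sum //; apply: eq_bigr => b _; by rewrite tot_sum.
  rewrite -tot_sum // -!totZ -totD.
  - by apply: eq_tot => x; rewrite -(row_deg a) -sum_sqr_variance.
  - by apply/(fsuppX 1)/fsupp_sum.
  - by apply: fsuppMr; exact: fsupp_sum.
have VS : spread t <= \sum_a V a.
  rewrite /V; under [leRHS]eq_bigr do rewrite big_mkcond /=.
  rewrite exchange_big /=; apply: ler_sum => b _.
  rewrite -big_mkcond /=.
  under [leRHS]eq_bigr do rewrite big_mkcond /=.
  rewrite exchange_big /=; apply: ler_sum => b' _.
  rewrite -big_mkcondr /=.
  have [a ab ab'] := common_pred b b'.
  rewrite (bigD1 a) ?ab ?ab' //= lerDl sumr_ge0 // => a' _.
  by apply: tot_ge0 => x; exact: sqr_ge0.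
have -> : d%:R ^+ 2 * nrm t = nrm (astep t) + 2^-1 * \sum_a V a.
  rewrite /nrm [X in _ = _ + X]mulr_sumr -big_split /=.
  under [RHS]eq_bigr do rewrite one.
  rewrite -mulr_sumr expr2 -mulrA; congr (_ * _).
  rewrite (exchange_big_dep xpredT) //= mulr_sumr; apply: eq_bigr => b _.
  by rewrite sumr_const col_deg mulr_natl.
by rewrite lerD2l ler_pM2l // invr_gt0.
Qed.

Variable c : R.
Hypothesis c0 : 0 < c.
Hypothesis gap : forall v : X -> R, (forall x, 0 <= v x) -> fsupp v ->
  c * tot (fun x => v x ^+ 2) <= \sum_a \sum_b disp act la v a b.
Local Notation n := (#|L|%:R : R).

Lemma nrm_le_sum t : (forall a x, 0 <= t a x) -> (forall a, fsupp (t a)) ->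
  nrm t <= tot (fun x => (\sum_a t a x) ^+ 2).
Proof.
move=> t0 ft; rewrite /nrm -tot_sum; last by move=> a; exact: (fsuppX 1).
apply: tot_le.
- by apply: fsupp_sum => a; exact: (fsuppX 1).
- exact/(fsuppX 1)/fsupp_sum.
move=> x; rewrite expr2 mulr_suml; apply: ler_sum => a _.
by rewrite expr2 ler_wpM2l // (bigD1 a) //= lerDl sumr_ge0.
Qed.

Lemma deg_le (a : L) : d%:R <= n.
Proof. by rewrite ler_nat -(row_deg a) max_card. Qed.

(** The left side is the square of a sum of differences [t b - t b'] over successors [b] of [a] and
    all [b']. Cauchy-Schwarz is applied to both sums, and [d <= n] gives [n ^ 2]. *)
Lemma astep_near_sum t a x :
  (n * astep t a x - d%:R * \sum_b t b (act x (la a))) ^+ 2 <=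
  n ^+ 2 * \sum_b \sum_b' (t b (act x (la a)) - t b' (act x (la a))) ^+ 2.
Proof.
set y := act x (la a).
have -> : n * astep t a x - d%:R * \sum_b t b y =
    \sum_(b | e a b) \sum_b' (t b y - t b' y).
  under [RHS]eq_bigr do rewrite big_split /= sumr_const sumrN.
  rewrite big_split /= sumr_const row_deg mulNrn.
  congr (_ - _); last exact: mulr_natl.
  by rewrite /astep mulr_sumr; apply: eq_bigr => b _; rewrite mulr_natl.
apply: le_trans (sqr_sum_le _ _) _; rewrite row_deg.
have S0 b : 0 <= n * \sum_b' (t b y - t b' y) ^+ 2.
  by rewrite mulr_ge0 // sumr_ge0 // => b' _; exact: sqr_ge0.
apply: (@le_trans _ _ (n * \sum_b n * \sum_b' (t b y - t b' y) ^+ 2)).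
  apply: ler_pM => //; first by apply: sumr_ge0 => b _; exact: sqr_ge0.
    exact: deg_le.
  rewrite [leRHS](bigID (e a)) /= ler_wpDr //; first exact: sumr_ge0.
  by apply: ler_sum => b _; apply: le_trans (sqr_sum_le _ _) _.
by rewrite -mulr_sumr mulrA expr2.
Qed.

Lemma sqrD3_le (x y z : R) :
  (x + y + z) ^+ 2 <= 3 * (x ^+ 2 + y ^+ 2 + z ^+ 2).
Proof.
rewrite -subr_ge0.
have -> : 3 * (x ^+ 2 + y ^+ 2 + z ^+ 2) - (x + y + z) ^+ 2 =
  (x - z) ^+ 2 + (y - z) ^+ 2 + (x - y) ^+ 2 by ring.
by rewrite !addr_ge0 ?sqr_ge0.
Qed.

(* Small [spread t] makes all the [t b] proportional to their sum [w], and then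
   [astep t a] is close to a multiple of the shift of [w] by [a]; small
   [spread (astep t)] thus makes [w] nearly invariant. *)
Lemma spread_gap t : (forall a x, 0 <= t a x) -> (forall a, fsupp (t a)) ->
  d%:R ^+ 2 * c * nrm t <= 6 * n ^+ 4 * (spread t + spread (astep t)).
Proof.
move=> t0 ft; pose w x := \sum_b t b x.
have w0 x : 0 <= w x by exact: sumr_ge0.
have fw : fsupp w by exact: fsupp_sum.
have fs := fsupp_astep ft.
pose Sp x := \sum_b \sum_b' (t b x - t b' x) ^+ 2.
have fSp : fsupp Sp.
  by apply: fsupp_sum => b; apply: fsupp_sum => b'; exact: fsupp_diff2.
have SpE : spread t = tot Sp.
  rewrite /spread tot_sum.
    by apply: eq_bigr => b _; rewrite tot_sum // => b'; exact: fsupp_diff2.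
  by move=> b; apply: fsupp_sum => b'; exact: fsupp_diff2.
have pair a b : d%:R ^+ 2 * disp act la w a b <= 3 * n ^+ 2 *
    (spread t + tot (fun x => (astep t a x - astep t b x) ^+ 2) + spread t).
  have fab := fsupp_diff2 a b fs.
  have fSa := fsupp_shift act1 actM (la a) fSp.
  have fSb := fsupp_shift act1 actM (la b) fSp.
  rewrite /disp SpE -{1}(tot_shift act1 actM (la a) Sp).
  rewrite -(tot_shift act1 actM (la b) Sp).
  rewrite -!totD // -?totZ; last exact: fsuppD.
  apply: tot_le.
  - exact: (fsuppZ _ (fsupp_disp act1 actM la a b fw)).
  - by apply: fsuppZ; do 2 apply: fsuppD => //.
  move=> x; have ha := astep_near_sum t a x; have hb := astep_near_sum t b x.
  rewrite -exprMn.
  have -> : d%:R * (w (act x (la a)) - w (act x (la b))) =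
    - (n * astep t a x - d%:R * w (act x (la a))) +
    n * (astep t a x - astep t b x) +
    (n * astep t b x - d%:R * w (act x (la b))) by ring.
  apply: le_trans (sqrD3_le _ _ _) _.
  rewrite sqrrN exprMn -[leRHS]mulrA ler_wpM2l // [leRHS]mulrDr.
  by rewrite [X in _ <= X + _]mulrDr lerD // lerD.
have [L0|/card_gt0P[a0 _]] := posnP #|L|.
  rewrite /nrm big_pred0 ?mulr0 => [|a]; last first.
    by have := card0_eq L0 a; rewrite inE.
  by rewrite mulr_ge0 ?addr_ge0 ?spread_ge0 // mulr_ge0 // exprn_ge0.
have n1 : 1 <= n by rewrite ler1n; apply/card_gt0P; exists a0.
rewrite -mulrA.
apply: (@le_trans _ _ (d%:R ^+ 2 * \sum_a \sum_b disp act la w a b)).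
  rewrite ler_wpM2l ?sqr_ge0 //; apply: le_trans (gap w0 fw).
  by rewrite ler_wpM2l ?nrm_le_sum // ltW.
rewrite mulr_sumr; under eq_bigr do rewrite mulr_sumr.
apply: le_trans (ler_sum _ (fun a _ => ler_sum _ (fun b _ => pair a b))) _.
under eq_bigr do rewrite -mulr_sumr !big_split /= sumr_const.
rewrite -mulr_sumr !big_split /= !sumr_const -/(spread (astep t)).
set s1 := spread t; set s2 := spread (astep t).
have s10 : 0 <= s1 by exact: spread_ge0.
have s20 : 0 <= s2 by exact: spread_ge0.
rewrite -subr_ge0.
have -> : 6 * n ^+ 4 * (s1 + s2) -
   3 * n ^+ 2 * (s1 *+ #|L| *+ #|L| + s2 + s1 *+ #|L| *+ #|L|) =
   3 * n ^+ 2 * s2 * (2 * n ^+ 2 - 1) by ring.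
have n21 : 1 <= n ^+ 2 by rewrite exprn_ege1.
by rewrite !mulr_ge0 ?sqr_ge0 //; lra.
Qed.

Hypothesis d0 : (0 < d)%N.

(** The defects of two consecutive steps together contain half of [spread t + spread (astep t)],
    which [spread_gap] bounds below by a fixed multiple of [nrm t]. *)
Lemma astep2_contract : exists th : R, [/\ 0 < th, th < d%:R ^+ 4 &
  forall t, (forall a x, 0 <= t a x) -> (forall a, fsupp (t a)) ->
    nrm (astep (astep t)) <= th * nrm t].
Proof.
have d1 : 1 <= d%:R :> R by rewrite ler1n.
have d40 : 0 < d%:R ^+ 4 :> R by rewrite exprn_gt0 //; lra.
pose k := 6 * n ^+ 4 + 1.
have n40 : 0 <= n ^+ 4 by rewrite exprn_ge0.
have k0 : 0 < k by rewrite /k; lra.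
pose c1 := d%:R ^+ 2 * c / (2 * k).
have c10 : 0 < c1 by rewrite divr_gt0 ?mulr_gt0 ?exprn_gt0 //; lra.
(* The maximum keeps the factor positive even if [c1] is at least [d ^ 4]. *)
exists (Num.max (d%:R ^+ 4 - c1) (d%:R ^+ 4 / 2)); split.
- by rewrite lt_max; apply/orP; right; lra.
- by rewrite gt_max; apply/andP; split; lra.
move=> t t0 ft; have fs := fsupp_astep ft.
apply: (@le_trans _ _ ((d%:R ^+ 4 - c1) * nrm t)); last first.
  by rewrite ler_wpM2r ?nrm_ge0 // le_max lexx.
have h1 := nrm_astep_le ft; have h2 := nrm_astep_le fs.
have s0 := spread_ge0 t; have s0' := spread_ge0 (astep t).
have g : c1 * nrm t <= 2^-1 * (spread t + spread (astep t)).
  have := spread_gap t0 ft => sg.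
  have : d%:R ^+ 2 * c * nrm t <= k * (spread t + spread (astep t)).
    by rewrite /k; lra.
  move=> h; rewrite /c1 [leLHS]mulrAC ler_pdivrMr ?mulr_gt0 //.
  by rewrite [leRHS](_ : _ = k * (spread t + spread (astep t))) //; field.
have d21 : 1 <= d%:R ^+ 2 :> R by rewrite exprn_ege1.
have h3 : d%:R ^+ 2 * (nrm (astep t) + 2^-1 * spread t) <=
    d%:R ^+ 2 * (d%:R ^+ 2 * nrm t) by rewrite ler_wpM2l ?sqr_ge0.
have h4 : 1 * (2^-1 * spread t) <= d%:R ^+ 2 * (2^-1 * spread t).
  by rewrite ler_wpM2r // mulr_ge0.
have e4 : d%:R ^+ 4 * nrm t = d%:R ^+ 2 * (d%:R ^+ 2 * nrm t) by ring.
lra.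
Qed.
End Automaton.

(** * Counting words by iterating the automaton *)

Lemma big_tupleS (R : nmodType) (L : finType) n (F : seq L -> R) :
  \sum_(w : n.+1.-tuple L) F w = \sum_a \sum_(w : n.-tuple L) F (a :: w).
Proof.
rewrite pair_bigA /=.
rewrite (reindex (fun p : L * n.-tuple L => [tuple of p.1 :: p.2])) //=.
exists (fun w : n.+1.-tuple L => (thead w, [tuple of behead w])).
  by move=> [a w] _; congr pair; apply: val_inj.
by move=> w _; apply: val_inj; case: w => -[|a w].
Qed.

Section Counting.
Variables (R : realType) (X : choiceType) (G : groupType).
Variable act : X -> G -> X.
Hypothesis act1 : forall x, act x 1%g = x.
Hypothesis actM : forall x g h, act (act x g) h = act x (g * h)%g.
Variables (L : finType) (la : L -> G) (e : rel L) (o : X).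

(** This is the condition at the end of a word, when only [a] remains to be read; iterating [astep]
    adds letters in front, so [n] iterations correspond to words of length [n + 1]. *)
Definition start (a : L) (x : X) : R := (act x (la a) == o)%:R.

Local Notation val w := (\prod_(a <- w) la a)%g.

Lemma iter_astepE n a x : iter n (astep act la e) start a x =
  \sum_(w : n.-tuple L) (path e a w && (act x (val (a :: w)) == o))%:R.
Proof.
elim: n a x => [|n IH] a x.
  rewrite (big_pred1 [tuple]) => [|w]; last exact/esym/eqP/tuple0.
  by rewrite big_cons big_nil mulg1.
rewrite iterS (big_tupleS _
  (fun w => (path e a w && (act x (val (a :: w)) == o))%:R : R)).
rewrite /astep big_mkcond; apply: eq_bigr => b _ /=.
case: (e a b); last by rewrite big1.
rewrite IH; apply: eq_bigr => w _ /=.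
by rewrite actM [in RHS]big_cons.
Qed.

Lemma card_sorted_tuples n :
  #|[pred w : n.+1.-tuple L | sorted e w && (act o (val w) == o)]|%:R =
  \sum_a iter n (astep act la e) start a o.
Proof.
rewrite -sum1_card natr_sum big_mkcond /=.
rewrite (eq_bigr (fun w : n.+1.-tuple L =>
    (sorted e w && (act o (val w) == o))%:R : R)).
  rewrite (big_tupleS _
    (fun w => (sorted e w && (act o (val w) == o))%:R : R)).
  by apply: eq_bigr => a _; rewrite iter_astepE.
by move=> w _; rewrite inE; case: (_ && _).
Qed.

Lemma fsupp_start a : fsupp (start a).
Proof.
exists [:: act o (la a)^-1%g] => x; rewrite inE /start => xo.
by case: eqP => // xao; move: xo; rewrite -xao actM mulgV act1 eqxx.
Qed.

Lemma iter_astep_ge0 n a x : 0 <= iter n (astep act la e) start a x.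
Proof.
rewrite iter_astepE; apply: sumr_ge0 => w _; exact: ler0n.
Qed.

Lemma fsupp_iter_astep n a : fsupp (iter n (astep act la e) start a).
Proof.
elim: n a => [|n IH] a; first exact: fsupp_start.
exact: (fsupp_astep act1 actM).
Qed.

Variable th : R.
Hypothesis th0 : 0 < th.
Hypothesis contract : forall t, (forall a x, 0 <= t a x) ->
  (forall a, fsupp (t a)) ->
  nrm (astep act la e (astep act la e t)) <= th * nrm t.

Lemma nrm_iter_le n i :
  nrm (iter (n.*2 + i) (astep act la e) start) <=
  th ^+ n * nrm (iter i (astep act la e) start).
Proof.
elim: n => [|n IH]; first by rewrite expr0 mul1r.
rewrite doubleS !addSn !iterS exprS -mulrA.
apply: le_trans (contract _ _) _; first exact: iter_astep_ge0.
  exact: fsupp_iter_astep.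
by rewrite ler_pM2l.
Qed.

(* The contraction acts on two steps at once, whence the parity [i]. *)
Lemma card_sorted_le : exists C : R, forall n i, (i <= 1)%N ->
  #|[pred w : (n.*2 + i).+1.-tuple L |
     sorted e w && (act o (val w) == o)]|%:R ^+ 2 <= C * th ^+ n.
Proof.
pose T n := iter n (astep act la e) start.
exists (#|L|%:R * (nrm (T 0%N) + nrm (T 1%N))) => n i i1.
(* Cauchy-Schwarz over the first letter reduces the count to values at the single point [o], whose
   squares are dominated by [nrm]. *)
rewrite card_sorted_tuples; apply: le_trans (sqr_sum_le _ _) _.
rewrite -mulrA ler_wpM2l //.
apply: (@le_trans _ _ (nrm (T (n.*2 + i)%N))).
  apply: ler_sum => a _.
  apply: (tot_ge_term (v := fun x => T _ a x ^+ 2)) => [|y].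
    exact/(fsuppX 1)/fsupp_iter_astep.
  exact: sqr_ge0.
apply: le_trans (nrm_iter_le n i) _; rewrite mulrC ler_wpM2r //.
  by rewrite exprn_ge0 // ltW.
by case: i i1 => [|[|]] // _; rewrite ?lerDl ?lerDr nrm_ge0.
Qed.
End Counting.

Section GrowthRate.
Import numFieldNormedType.Exports.

(** Choose [E] strictly between the fourth root of [th] and [D]. Eventually [a m <= E ^ m], because
    the factor [C] is absorbed by a geometric sequence; this bounds the upper limit by [E < D]. *)
Lemma growth_rate_lt (R : realType) (a : nat -> nat) (C th D : R) :
  0 < th -> 0 < D -> th < D ^+ 4 ->
  (forall n i, (i <= 1)%N -> (a (n.*2 + i).+1)%:R ^+ 2 <= C * th ^+ n) ->
  (growth_rate R a < D%:E)%E.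
Proof.
move=> th0 D0 thD aC.
pose tau : R := Num.sqrt (Num.sqrt th).
have tau0 : 0 < tau by rewrite !sqrtr_gt0.
have tau4 : tau ^+ 4 = th.
  by rewrite (exprM tau 2 2) sqr_sqrtr ?sqrtr_ge0 // sqr_sqrtr // ltW.
have tauD : tau < D.
  by rewrite -(@ltr_pXn2r _ 4) ?nnegrE ?(ltW tau0) ?(ltW D0) // tau4.
pose E : R := (tau + D) / 2.
have tauE : tau < E by rewrite /E; lra.
have ED : E < D by rewrite /E; lra.
have E0 : 0 < E by lra.
have r0 : 0 <= tau / E by exact: divr_ge0 (ltW tau0) (ltW E0).
pose q : R := (tau / E) ^+ 4.
have q0 : 0 <= q by exact: exprn_ge0.
have q1 : q < 1.
  rewrite /q -[ltRHS](expr1n _ 4) ltr_pXn2r // ?nnegrE //.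
  by rewrite ltr_pdivrMr // mul1r.
(* Writing the index as [2n + i + 1], its double is [4n + 2 + 2i]; the surplus power of [E] is 2 or
   4 according to the parity [i]. *)
pose k := Num.min (E ^+ 2) (E ^+ 4).
have k0 : 0 < k by rewrite lt_min !exprn_gt0.
have [n0 n0P] : exists n0, forall n, (n0 <= n)%N -> C * q ^+ n <= k.
  have : ((fun n => C * q ^+ n) @ \oo --> (C * 0 : R))%classic.
    by apply: cvgMl_tmp; apply: cvg_expr; rewrite ger0_norm.
  rewrite mulr0 => /cvgrPdist_le /(_ k k0) [n0 _ n0P]; exists n0 => n /n0P /=.
  rewrite /= sub0r normrN => Cq; apply: le_trans (ler_norm _) _.
  exact: Cq.
have aE m : (n0.*2 < m)%N -> (a m)%:R <= E ^+ m.
  case: m => // m; rewrite ltnS => n0m.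
  have mE : m = (m./2.*2 + odd m)%N by rewrite addnC odd_double_half.
  have := aC m./2 (odd m) (leq_b1 _); rewrite -mE => am.
  rewrite -(@ler_pXn2r _ 2) ?nnegrE ?exprn_ge0 ?(ltW E0) //.
  apply: le_trans am _.
  have n0m2 : (n0 <= m./2)%N by rewrite geq_half_double.
  have Cq := n0P _ n0m2.
  have -> : C * th ^+ m./2 = C * q ^+ m./2 * E ^+ (4 * m./2).
    rewrite -tau4 /q exprM -mulrA -exprMn -exprMn divfK //.
    by rewrite gt_eqF.
  apply: le_trans (ler_wpM2r _ Cq) _; first by rewrite exprn_ge0 // ltW.
  rewrite -exprM {2}mE.
  have -> : ((m./2.*2 + odd m).+1 * 2 = 4 * m./2 + (2 + 2 * odd m))%N.
    by rewrite -mul2n; move: m./2 (odd m : nat) => u v; clear; lia.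
  rewrite exprD mulrC ler_wpM2l ?exprn_ge0 ?(ltW E0) //.
  by rewrite ge_min; case: (odd m); rewrite lexx ?orbT.
apply: le_lt_trans (_ : _ <= E%:E)%E _; last by rewrite lte_fin.
rewrite /growth_rate /limn_esup limf_esupE.
apply: le_trans (ereal_inf_lbound _) _.
  by exists [set m | (n0.*2 < m)%N]%classic => //; exact: nbhs_infty_gt.
apply: ge_ereal_sup => _ [m /= n0m <-]; rewrite lee_fin.
have m0 : (m != 0)%N by rewrite -lt0n (leq_ltn_trans _ n0m).
have mR0 : m%:R != 0 :> R by rewrite pnatr_eq0.
have -> : E = (E ^+ m) `^ m%:R^-1.
  by rewrite -powR_mulrn ?(ltW E0) // -powRrM divff // powRr1 // ltW.
by rewrite ge0_ler_powR ?nnegrE ?invr_ge0 ?exprn_ge0 ?(ltW E0) // aE.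
Qed.
End GrowthRate.

(** * Growth of words representing elements of the subgroup *)

Section Cosets.
Variables (G : groupType) (H : groupClosed G).

(** [choose] gives the same element for equivalent predicates, whatever admissible starting point it
    receives; this yields one representative per right coset. *)
Definition coset_repr (g : G) : G := choose [pred y | (y * g^-1)%g \in H] g.

Lemma coset_repr_mem g : (coset_repr g * g^-1)%g \in H.
Proof.
have gP : [pred y | (y * g^-1)%g \in H] g by rewrite /= mulgV gpred1.
exact: (chooseP gP).
Qed.

Lemma coset_repr_eq g g' : (g * g'^-1)%g \in H -> coset_repr g = coset_repr g'.
Proof.
move=> gg'; have e : [pred y | (y * g^-1)%g \in H] =1
    [pred y | (y * g'^-1)%g \in H].
  move=> y /=; have -> : (y * g'^-1 = y * g^-1 * (g * g'^-1))%g.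
    by rewrite mulgA mulgVK.
  exact/esym/gpredMr.
rewrite /coset_repr (eq_choose e); apply: choose_id => //=.
by rewrite mulgV gpred1.
Qed.

Lemma coset_repr_idem g : coset_repr (coset_repr g) == coset_repr g.
Proof. by apply/eqP/coset_repr_eq/coset_repr_mem. Qed.

(* The coset [H g] is encoded by its canonical representative. *)
Definition rcosets_of : Type := {g : G | coset_repr g == g}.
HB.instance Definition _ := Choice.on rcosets_of.

Definition rcoset_of (g : G) : rcosets_of :=
  exist _ (coset_repr g) (coset_repr_idem g).

Definition rcoset_act (c : rcosets_of) (g : G) : rcosets_of :=
  rcoset_of (sval c * g)%g.

Lemma rcoset_of_eq g g' : (rcoset_of g == rcoset_of g') = ((g * g'^-1)%g \in H).
Proof.
apply/eqP/idP => [[gg']|/coset_repr_eq e]; last exact: val_inj.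
have := coset_repr_mem g; rewrite gg' -gpredV invgM invgK => h.
have := gpredM _ _ h (coset_repr_mem g').
by rewrite mulgA mulgVK.
Qed.

Lemma rcoset_act1 c : rcoset_act c 1%g = c.
Proof. by apply: val_inj; rewrite /= mulg1; apply/eqP; case: c. Qed.

Lemma rcoset_actM c g h :
  rcoset_act (rcoset_act c g) h = rcoset_act c (g * h)%g.
Proof.
apply: val_inj => /=; apply: coset_repr_eq.
have := coset_repr_mem (sval c * g)%g.
by rewrite !invgM !mulgA mulgK.
Qed.

Lemma rcoset_act_base g :
  (rcoset_act (rcoset_of 1%g) g == rcoset_of 1%g) = (g \in H).
Proof.
have -> : rcoset_act (rcoset_of 1%g) g = rcoset_of g.
  apply: val_inj; apply: coset_repr_eq.
  by have := coset_repr_mem 1%g; rewrite invg1 mulg1 mulgK.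
by rewrite rcoset_of_eq invg1 mulg1.
Qed.
End Cosets.

Section SortedWords.
Variables (R : realType) (G : groupType) (k : nat) (x : 'I_k -> G).
Variable H : groupClosed G.
Hypothesis gen_x : forall g : G, exists w, word_val x w = g.
Local Notation S := (range x).

Lemma range_generates : generates S.
Proof.
move=> g; have [w <-] := gen_x g.
exists [seq (x a.1, a.2) | a <- w].
  by move=> a /mapP[b _ ->]; exists b.1.
by rewrite /word_val big_map.
Qed.

Lemma range_finite : finite_set S.
Proof. exact/finite_image/finite_finset. Qed.

(** All generators equal one element [c], taken to be 1 if there are none, so the group is cyclic.
    Its use is the converse: a non-elementary group comes with at least two generators. *)
Lemma few_generators_virtually_cyclic : (k <= 1)%N -> virtually_cyclic G.
Proof.
move=> k1; have [c xc] : exists c, forall i, x i = c.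
  have [k0|k0] := posnP k; first by exists 1%g => i; have := ltn_ord i; lia.
  exists (x (Ordinal k0)) => i; congr x; apply: val_inj => /=.
  by have := ltn_ord i; lia.
exists c; apply: (@finite_index_cover _ _ [:: 1%g]).
- by move=> a b; refine (@cyclic_subgroupM _ _ _ _).
- by move=> a; refine (@cyclic_subgroupV _ _ _).
move=> g; exists g, 1%g; rewrite mulg1 mem_head; split => //.
have [w <-] := gen_x g; elim: w => [|[i b] w IH].
  by exists 0%N; left; rewrite word_val_nil.
rewrite word_val_cons; refine (cyclic_subgroupM _ IH).
by exists 1%N; rewrite /letter_val /= xc; case: b; [right|left].
Qed.

Hypothesis hypG : hyperbolic R G.
Hypothesis nonelemG : ~ virtually_cyclic G.
Hypothesis qcH : quasiconvex R H.
Hypothesis infH : ~ finite_index [set` H]%classic.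

Local Notation act := (@rcoset_act G H).

Lemma energy_gap : exists (Q : seq G) (c : R), 0 < c /\
  forall v : rcosets_of H -> R, fsupp v ->
    c * tot (fun y => v y ^+ 2) <= \sum_(q <- Q) energy act q v.
Proof.
have genS := range_generates; have finS := range_finite.
have [_ /(_ S (conj finS genS))[delta _ thin]] := hypG.
have [D thinD] := discrete_thin genS thin.
have four_pt := four_point genS thinD.
have [E qcE] := discrete_quasiconvex genS qcH finS.
have qcQ a b c : b \in H -> c \in H -> exists2 h, h \in H &
    (2 * wdist S a h + wdist S b c <=
     wdist S a b + wdist S a c + (4 * D + 2 + E.*2))%N.
  move=> bH cH; have [h hH le_h] :=
    quasiconvex_gromov_product genS thinD a qcE bH cH.
  by exists h => //; rewrite mul2n.
have [Q [symQ drift]] := positive_drift genS finS four_pt qcQ infH nonelemG.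
pose d (y : rcosets_of H) := dist_to S H (sval y).
(* The action passes to the chosen representative, which changes the element by a left factor in [H]
   and leaves the distance to [H] unchanged. *)
have dE y q : d (act y q) = dist_to S H (sval y * q)%g.
  rewrite /d /= -(dist_toM S (sval y * q)%g (coset_repr_mem H (sval y * q)%g)).
  by rewrite mulgVK.
have lip y q : q \in Q ->  (d (act y q) <= d y + \sum_(q <- Q) wlen S q)%N /\
    (d y <= d (act y q) + \sum_(q <- Q) wlen S q)%N.
  move=> qQ; rewrite dE (big_rem q) //=.
  have := dist_to_lip genS H (sval y) q; have := dist_to_lipV genS H (sval y) q.
  by rewrite /d; lia.
have actM := @rcoset_actM G H; have act1 := @rcoset_act1 G H.
have drift' y : (size Q * d y < \sum_(q <- Q) d (act y q))%N.
  by under eq_bigr do rewrite dE; exact: drift.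
have [l [rho [l0 rhoQ super]]] := drift_superharmonic R lip drift'.
exists Q, (2 * ((size Q)%:R - rho)); split; first by lra.
move=> v fv.
apply: (superharmonic_gap act1 actM symQ (f := fun y => l ^+ d y)) => //.
by move=> y; exact: exprn_gt0.
Qed.

(** Both counts are instances: [e] forbids only the inverse of the preceding letter, with
    [d = 2k - 1], or [e] allows everything, with [d = 2k]. *)
Lemma sorted_words_growth (e : rel ('I_k * bool)) (d : nat) :
  (forall a, #|[pred b | e a b]| = d) -> (forall b, #|[pred a | e a b]| = d) ->
  (forall b b', exists2 a, e a b & e a b') ->
  (growth_rate R (fun n => #|[pred w : n.-tuple ('I_k * bool) |
    sorted e w && (word_val x w \in H)]|) < (d%:R : R)%:E)%E.
Proof.
move=> row col common; have actM := @rcoset_actM G H.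
have act1 := @rcoset_act1 G H.
have k0 : (0 < k)%N.
  rewrite lt0n; apply/eqP => k0.
  by apply/nonelemG/few_generators_virtually_cyclic; rewrite k0.
pose a0 : 'I_k * bool := (Ordinal k0, true).
have d0 : (0 < d)%N.
  have [a ab _] := common a0 a0.
  by rewrite -(row a); apply/card_gt0P; exists a0.
have gen g :
    exists w : seq ('I_k * bool), g = (\prod_(a <- w) letter_val x a)%g.
  by have [w <-] := gen_x g; exists w.
have [Q [c [c0 gapQ]]] := energy_gap.
have [c1 c10 gap1] := energy_gap_gen act1 actM gen c0 gapQ.
have [c2 c20 gap2] := energy_gap_pairs act1 actM (letter_val_inv x) a0 c10 gap1.
have [th [th0 thd contr]] :=
  astep2_contract act1 actM row col common c20 gap2 d0.
have [C CP] := card_sorted_le act1 actM (rcoset_of H 1%g) th0 contr.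
apply: (@growth_rate_lt R _ C th) => //; first by rewrite ltr0n.
move=> n i i1; have := CP n i i1; congr (_%:R ^+ 2 <= _).
by apply: eq_card => w; rewrite !inE rcoset_act_base.
Qed.
End SortedWords.

Theorem corollary1p4 (R : realType) (G : groupType) (k m : nat)
    (x : 'I_k -> G) (r : 'I_m -> seq (letter 'I_k)) (H : groupClosed G)
    (presG : has_presentation x r)
    (hypG : hyperbolic R G)
    (nonelemG : ~ virtually_cyclic G)
    (qcH : quasiconvex R H)
    (infH : ~ finite_index [set` H]%classic) :
  (growth_rate R (num_reduced_words x H) < (2 * k%:R - 1)%:E)%E /\
  (growth_rate R (num_words x H) < (2 * k%:R)%:E)%E.
Proof.
have gen_x := presG.1.
have k1 : (1 < k)%N.
  by rewrite ltnNge; apply/negP => /(few_generators_virtually_cyclic gen_x).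
have cardL : #|{: 'I_k * bool}| = (2 * k)%N.
  by rewrite card_prod card_ord card_bool mulnC.
have invK : involutive (@inv_letter 'I_k).
  by case=> i b; rewrite /inv_letter /= negbK.
have inv_sym (a b : 'I_k * bool) : (b != inv_letter a) = (a != inv_letter b).
  by rewrite eq_sym (can2_eq invK invK).
have card_inv (a : 'I_k * bool) :
    #|[pred b : 'I_k * bool | b != inv_letter a]| = (2 * k).-1.
  by rewrite -cardL -(cardC1 (inv_letter a)); apply: eq_card.
have ssw := sorted_words_growth gen_x hypG nonelemG qcH infH.
split.
  have -> : 2 * k%:R - 1 = (2 * k).-1%:R :> R.
    by rewrite -subn1 natrB ?natrM // muln_gt0 (ltn_trans _ k1).
  apply: ssw => [a|b|b b'].
  - exact: card_inv.
  - by rewrite -(card_inv b); apply: eq_card => a; rewrite !inE inv_sym.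
  (* Without a common predecessor of [b] and [b'], every letter would be the inverse of one of them,
     leaving at most two letters, although [k > 1] gives at least four. *)
  apply: contrapT => /forall2NP no.
  have : (#|{: 'I_k * bool}| <= #|[set inv_letter b; inv_letter b']|)%N.
    apply: subset_leq_card; apply/fintype.subsetP => a _; rewrite !inE.
    by have [|] := no a; rewrite inv_sym => /negP/negPn ->; rewrite ?orbT.
  by rewrite cardL cards2; lia.
have -> : 2 * k%:R = (2 * k)%:R :> R by rewrite natrM.
have -> : num_words x H = fun n => #|[pred w : n.-tuple ('I_k * bool) |
    sorted (fun _ _ => true) w && (word_val x w \in H)]|.
  apply/funext => n; apply: eq_card => w; rewrite !inE.
  by have -> : sorted (fun _ _ => true) w by elim: (val w) => [//|a [|b s]].
apply: ssw => [a|b|b b']; rewrite -?cardL.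
- by apply: eq_card => b; rewrite !inE.
- by apply: eq_card => a; rewrite !inE.
- by exists b.
Qed.
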